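(* Let $\mathfrak g$ be a vector space over a field of characteristic zero with two commuting linear maps $\alpha,\beta:\mathfrak g\to\mathfrak g$. For $i,j\ge1$ let $$B^{i,j}=\{\phi\in\mathrm{Hom}(\Lambda^i\mathfrak g,\Lambda^j\mathfrak g):\ \alpha^{\otimes j}\phi=\phi\alpha^{\otimes i},\ \beta^{\otimes j}\phi=\phi\beta^{\otimes i}\},$$ and $B^{i,j}=\{0\}$ otherwise, where elements of $B^{i,j}$ have degree $j-i$ and height $(i-1,j-1)$. Then the bracket $$\{\phi,\psi\}_{\mathrm{GC}}=\phi\circ\psi-(-1)^{\deg(\phi)\deg(\psi)}\psi\circ\phi,$$ with the product $\circ$ defined in the context, extended bilinearly, defines a graded Lie algebra structure on $B^{\bullet\bullet}=\bigoplus_{i,j}B^{i,j}$.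
   Context: $\Lambda^\bullet\mathfrak g$ is the Grassmann algebra, graded with $\mathfrak g$ in degree $1$, with product $\mu$ and coproduct $\Delta$, the (graded) algebra morphism determined by $\Delta(x)=1\otimes x+x\otimes1$ for $x\in\mathfrak g$. Tensor products of maps follow the Koszul sign rule $(\phi\otimes\psi)(x\otimes y)=(-1)^{\deg(\psi)\deg(x)}\phi(x)\otimes\psi(y)$. The maps $\alpha,\beta$ are extended to $\Lambda^\bullet\mathfrak g$ as algebra (Hopf algebra) morphisms, denoted by the same letters, i.e. by $\alpha^{\otimes k}$, $\beta^{\otimes k}$ on $\Lambda^k\mathfrak g$. $\mathrm{pr}:\Lambda^\bullet\mathfrak g\to\mathfrak g$ is the projection. A map in $\mathrm{Hom}(\Lambda^i\mathfrak g,\Lambda^j\mathfrak g)$ is regarded as a map $\Lambda^\bullet\mathfrak g\to\Lambda^\bullet\mathfrak g$ of degree $j-i$, extended by zero. For a map $\phi$ with height $|\phi|=(|\phi|_\alpha,|\phi|_\beta)$ put $\alpha^\phi=\alpha^{|\phi|_\alpha}\beta^{|\phi|_\beta}$; so for $\phi\in B^{i,j}$, $\alpha^\phi=\alpha^{i-1}\beta^{j-1}$. The product is $$\psi\circ\phi=\mu\,(\psi\otimes\alpha^\psi)\,(\mu\otimes\mathrm{id})\,(\mathrm{id}\otimes\mathrm{pr}\otimes\mathrm{id})\,(\mathrm{id}\otimes\Delta)\,(\alpha^\phi\otimes\phi)\,\Delta .$$ For $\phi\in B^{i,j}$, $\psi\in B^{k,l}$ one has $\psi\circ\phi\in B^{i+k-1,j+l-1}$.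 ''Graded Lie algebra'' is with respect to the degree $\deg$: the bracket has degree $0$, is graded skew-symmetric, and satisfies the graded Jacobi identity. *)

(* Defs.v *)
From HB Require Import structures.
From mathcomp Require Import all_boot all_order all_algebra.
From mathcomp Require Import ring_quotient generic_quotient finmap.
From mathcomp Require Import boolp functions.
From mathcomp Require Import monalg zify.

Set Implicit Arguments.
Unset Strict Implicit.
Unset Printing Implicit Defensive.

Import GRing.Theory.
Local Open Scope ring_scope.
Local Open Scope quotient_scope.

Section SpanQuotient.
Variables (K : fieldType) (V : lmodType K) (R : V -> Prop).

Inductive lspan : V -> Prop :=
| lspan_nil : lspan 0
| lspan_cons a u v of R u & lspan v : lspan (a *: u + v).

Definition lspan_pred : pred V := fun x => `[< lspan x >].

Lemma lspan_predP x : reflect (lspan x) (x \in lspan_pred).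
Proof. exact: asboolP. Qed.

Lemma lspan_linear a u v : lspan u -> lspan v -> lspan (a *: u + v).
Proof.
move=> Su Sv; elim: Su => [|b x y Rx _ IH]; first by rewrite scaler0 add0r.
by rewrite scalerDr scalerA -addrA; apply: lspan_cons.
Qed.

Lemma lspan_gen u : R u -> lspan u.
Proof.
by move=> Ru; rewrite -[u]addr0 -[u]scale1r; apply: lspan_cons Ru lspan_nil.
Qed.

Fact lspan_pred_closed : submod_closed lspan_pred.
Proof.
split; first by apply/lspan_predP/lspan_nil.
move=> a u v /lspan_predP Su /lspan_predP Sv.
by apply/lspan_predP/lspan_linear.
Qed.
HB.instance Definition _ := GRing.isSubmodClosed.Build K V lspan_pred
  lspan_pred_closed.

Local Notation Q := (Quotient.quot (GRing.ZmodClosed.clone V lspan_pred _)).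
Let pi (x : V) : Q := \pi_Q x.

Let pi_eq x y : pi x = pi y <-> lspan (x - y).
Proof.
rewrite /pi; split=> [/eqP|S]; last apply/eqP.
  by rewrite -Quotient.idealrBE => /lspan_predP.
by rewrite -Quotient.idealrBE; apply/lspan_predP.
Qed.

Let piD : {morph pi : x y / x + y}.
Proof. by move=> x y; exact: Quotient.pi_add. Qed.

Let pi_repr x : pi (repr x) = x. Proof. exact: reprK. Qed.

Let scale (a : K) (x : Q) : Q := pi (a *: repr x).

Let piZ a x : pi (a *: x) = scale a (pi x).
Proof.
apply/pi_eq; rewrite -scalerBr -[X in lspan X]addr0.
by apply: lspan_linear lspan_nil; apply/pi_eq; rewrite pi_repr.
Qed.

Let scaleA a b x : scale a (scale b x) = scale (a * b) x.
Proof. by rewrite -[x]pi_repr -!piZ scalerA. Qed.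
Let scale1 : left_id 1 scale.
Proof. by move=> x; rewrite -[x]pi_repr -!piZ scale1r. Qed.
Let scaleDr : right_distributive scale +%R.
Proof.
by move=> a x y; rewrite -[x]pi_repr -[y]pi_repr -piD -!piZ scalerDr piD.
Qed.
Let scaleDl x : {morph scale^~ x : a b / a + b}.
Proof. by move=> a b; rewrite -[x]pi_repr -!piZ scalerDl piD. Qed.

Record lquotient := LQuotient {
  lquot_type : lmodType K;
  lquot_pi : {linear V -> lquot_type};
  lquot_repr : lquot_type -> V;
  lquot_reprK : cancel lquot_repr lquot_pi;
  lquot_piP : forall x y, lquot_pi x = lquot_pi y <-> lspan (x - y)
}.

(* Opaque on purpose: the quotient of V by the span of R is only used through
   the fields above, which keeps unification away from its construction. *)
Fact the_lquotient : lquotient.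
Proof.
pose M := GRing.Zmodule_isLmodule.Build K Q scaleA scale1 scaleDr scaleDl.
pose L : lmodType K := HB.pack Q M.
have pil : linear (pi : V -> L) by move=> a x y; rewrite piD piZ.
pose P := GRing.isLinear.Build K V L _ (pi : V -> L) pil.
pose pi' : {linear V -> L} := HB.pack (pi : V -> L) P.
exact: (@LQuotient L pi' repr pi_repr pi_eq).
Qed.

Section Lift.
Variables (q : lquotient) (W : lmodType K) (f : V -> W).

(* f is meant to be linear and to vanish on R. *)
Definition llift (x : lquot_type q) : W := f (lquot_repr x).

Hypotheses (flin : linear f) (fR : forall u, R u -> f u = 0).

Lemma lliftE x : llift (lquot_pi q x) = f x.
Proof.
have f0 : f 0 = 0.
  by have := flin (-1) 0 0; rewrite scaler0 addr0 scaleN1r addNr.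
have fspan u : lspan u -> f u = 0.
  by elim=> // a v w Rv _ fw; rewrite flin fw fR // scaler0 addr0.
have /lquot_piP/fspan := lquot_reprK (lquot_pi q x).
rewrite addrC -scaleN1r flin scaleN1r /llift => /eqP.
by rewrite addrC subr_eq0 => /eqP.
Qed.

Lemma llift_linear : linear llift.
Proof.
move=> a x y; rewrite -[x]lquot_reprK -[y]lquot_reprK -linearP !lliftE.
by rewrite flin.
Qed.
End Lift.
End SpanQuotient.

Section FreeModule.
Variables (K : fieldType) (I : choiceType) (W : lmodType K).

Definition lext (h : I -> W) (x : {malg K[I]}) : W :=
  \sum_(k <- msupp x) x@_k *: h k.

Lemma lextEw h (d : {fset I}) x : (msupp x `<=` d)%fset ->
  lext h x = \sum_(k <- d) x@_k *: h k.
Proof.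
move=> le; rewrite [LHS](big_fset_incl _ le) //= => k _ /mcoeff_outdom ->.
by rewrite scale0r.
Qed.

Lemma lext_linear h : linear (lext h).
Proof.
move=> a x y; pose d := (msupp x `|` msupp y `|` msupp (a *: x + y))%fset.
have lx : (msupp x `<=` d)%fset by rewrite /d -fsetUA fsubsetUl.
have ly : (msupp y `<=` d)%fset.
  by rewrite /d [(msupp x `|` _)%fset]fsetUC -fsetUA fsubsetUl.
have lz : (msupp (a *: x + y) `<=` d)%fset by rewrite /d fsubsetUr.
rewrite (lextEw h lx) (lextEw h ly) (lextEw h lz) scaler_sumr -big_split /=.
by apply: eq_bigr => k _; rewrite mcoeffD mcoeffZ scalerDl scalerA.
Qed.
HB.instance Definition _ h :=
  GRing.isLinear.Build K {malg K[I]} W _ (lext h) (lext_linear h).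

Lemma lextU h k : lext h << k >> = h k.
Proof. by rewrite /lext msuppU oner_eq0 big_seq_fset1 mcoeffUU scale1r. Qed.

Lemma malg_linear_ext (f g : {malg K[I]} -> W) : linear f -> linear g ->
  (forall k, f << k >> = g << k >>) -> f =1 g.
Proof.
move=> fl gl fg x; pose F := GRing.isLinear.Build K _ _ _ f fl.
pose G := GRing.isLinear.Build K _ _ _ g gl.
pose F' : {linear _ -> _} := HB.pack f F.
pose G' : {linear _ -> _} := HB.pack g G.
have E k : << x@_k *g k >> = x@_k *: << k >> :> {malg K[I]}.
  apply/malgP=> i; rewrite mcoeffZ !mcoeffU.
  by case: eqP; rewrite ?mulr1 ?mulr0.
rewrite [x]monalgE -[f _]/(F' _) -[g _]/(G' _) !linear_sum.
by apply: eq_bigr => k _; rewrite E !linearZ /= fg.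
Qed.
End FreeModule.

Section Tensor.
Variable K : fieldType.
Variables (U V : lmodType K).

Inductive tensor_rel : {malg K[(U * V)%type]} -> Prop :=
| tensor_rell a u u' v :
    tensor_rel (<< (a *: u + u', v) >> - (a *: << (u, v) >> + << (u', v) >>))
| tensor_relr a u v v' :
    tensor_rel (<< (u, a *: v + v') >> - (a *: << (u, v) >> + << (u, v') >>)).

Definition tensor : lmodType K := lquot_type (the_lquotient tensor_rel).
Definition tens (u : U) (v : V) : tensor :=
  lquot_pi (the_lquotient tensor_rel) << (u, v) >>.

Lemma tens_linearl v : linear (tens^~ v).
Proof.
move=> a u u'; rewrite /tens -linearP; apply/lquot_piP/lspan_gen.
exact: tensor_rell.
Qed.
Lemma tens_linearr u : linear (tens u).
Proof.
move=> a v v'; rewrite /tens -linearP; apply/lquot_piP/lspan_gen.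
exact: tensor_relr.
Qed.
HB.instance Definition _ u :=
  GRing.isLinear.Build K V tensor _ (tens u) (tens_linearr u).

Lemma tensor_ext (W : lmodType K) (f g : tensor -> W) :
  linear f -> linear g -> (forall u v, f (tens u v) = g (tens u v)) -> f =1 g.
Proof.
move=> fl gl fg x; rewrite -[x]lquot_reprK.
apply: (@malg_linear_ext K _ W (f \o lquot_pi _) (g \o lquot_pi _)).
- by move=> a y z /=; rewrite linearP fl.
- by move=> a y z /=; rewrite linearP gl.
- by case=> u v; apply: fg.
Qed.

Section Lift.
Variables (W : lmodType K) (f : U -> V -> W).

(* f is meant to be bilinear. *)
Definition tlift : tensor -> W :=
  llift (q := the_lquotient tensor_rel) (lext (fun p => f p.1 p.2)).

Hypotheses (fl : forall v, linear (f^~ v)) (fr : forall u, linear (f u)).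

Let fR x : tensor_rel x -> lext (fun p => f p.1 p.2) x = 0.
Proof.
by case=> a *; rewrite linearB linearP /= !lextU /= ?fl ?fr subrr.
Qed.

Lemma tlift_linear : linear tlift.
Proof. exact: llift_linear (lext_linear _) fR. Qed.

Lemma tlift_tens u v : tlift (tens u v) = f u v.
Proof. by rewrite /tlift /tens lliftE ?lextU //; apply: lext_linear. Qed.
End Lift.
End Tensor.

Notation "x ⊗ y" := (tens x y) (at level 38, left associativity) : ring_scope.

Section TensorMaps.
Variable K : fieldType.

Definition tmap (U V U' V' : lmodType K) (f : U -> U') (g : V -> V') :
  tensor U V -> tensor U' V' := tlift (fun u v => f u ⊗ g v).

Definition tassoc (U V W : lmodType K) :
    tensor U (tensor V W) -> tensor (tensor U V) W :=
  tlift (fun u => tlift (fun v w => u ⊗ v ⊗ w)).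
End TensorMaps.

Section Words.
Variable T : choiceType.
Definition word := seq T.
HB.instance Definition _ := Choice.on word.

Fact word_unit (u v : word) : u ++ v = [::] -> u = [::] /\ v = [::].
Proof. by case: u. Qed.
HB.instance Definition _ := Choice_isMonomialDef.Build word
  (@catA T) (@cat0s T) (@cats0 T) word_unit.
End Words.

Section Grassmann.
Variables (K : fieldType) (g : lmodType K).
Local Notation A := {malg K[word g]}.

Let malg_scalerAr (c : K) (u v : A) : c *: (u * v) = u * (c *: v).
Proof.
have E (w : A) : w * c%:MP = c *: w.
  rewrite malgM_def malgZ_def fgmulgU; apply: eq_bigr => k _.
  by rewrite mulm1 mulrC.
by rewrite -[c *: v]mul_malgC mulrA E scalerAl.
Qed.

Let malg_mulU (u v : word g) : << u >> * << v >> = << (u ++ v : word g) >> :> A.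
Proof. by rewrite malgM_def fgmulUU mulr1. Qed.

Definition fgen (x : g) : A := << ([:: x] : word g) >>.

(* The lspan of grassmann_rel is the two-sided ideal of the free algebra on the
   set g generated by the linearity relations and by the squares x * x. *)
Inductive grassmann_rel : A -> Prop :=
| grassmann_rel_lin p q a x y :
    grassmann_rel (p * (fgen (a *: x + y) - (a *: fgen x + fgen y)) * q)
| grassmann_rel_sq p q x : grassmann_rel (p * (fgen x * fgen x) * q).

Definition grassmann_mod : Type := lquot_type (the_lquotient grassmann_rel).
HB.instance Definition _ := GRing.Lmodule.on grassmann_mod.

Local Notation pi := (lquot_pi (the_lquotient grassmann_rel)).
Local Notation I := (lspan grassmann_rel).

Let I_mull p u : I u -> I (p * u).
Proof.
elim=> [|a v w Rv _ IH]; first by rewrite mulr0; apply: lspan_nil.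
rewrite mulrDr -malg_scalerAr; apply: lspan_cons => //.
case: Rv => [p' q b x y|p' q x]; rewrite [p * (_ * q)]mulrA [p * (p' * _)]mulrA.
  exact: grassmann_rel_lin.
exact: grassmann_rel_sq.
Qed.

Let I_mulr q u : I u -> I (u * q).
Proof.
elim=> [|a v w Rv _ IH]; first by rewrite mul0r; apply: lspan_nil.
rewrite mulrDl -scalerAl; apply: lspan_cons => //.
case: Rv => [p q' b x y|p q' x]; rewrite -[_ * q' * q]mulrA.
  exact: grassmann_rel_lin.
exact: grassmann_rel_sq.
Qed.

Definition gmod_mul (x y : grassmann_mod) : grassmann_mod :=
  pi (lquot_repr x * lquot_repr y).

Fact gpi_mul u v : pi (u * v) = gmod_mul (pi u) (pi v).
Proof.
set u' := lquot_repr (pi u); set v' := lquot_repr (pi v).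
apply/(lquot_piP (the_lquotient _)).
have Iu : I (u - u').
  by apply/(lquot_piP (the_lquotient _)); rewrite lquot_reprK.
have Iv : I (v - v').
  by apply/(lquot_piP (the_lquotient _)); rewrite lquot_reprK.
have -> : u * v - u' * v' = 1 *: ((u - u') * v) + (u' * (v - v')).
  by rewrite scale1r mulrBl mulrBr addrA subrK.
by apply: lspan_linear; [apply: I_mulr | apply: I_mull].
Qed.

Definition gmod_one : grassmann_mod := pi 1.

Fact gmulA : associative gmod_mul.
Proof.
move=> x y z; rewrite -[x]lquot_reprK -[y]lquot_reprK -[z]lquot_reprK.
by rewrite -!gpi_mul mulrA.
Qed.
Fact gmul1r : left_id gmod_one gmod_mul.
Proof. by move=> x; rewrite -[x]lquot_reprK -gpi_mul mul1r. Qed.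
Fact gmulr1 : right_id gmod_one gmod_mul.
Proof. by move=> x; rewrite -[x]lquot_reprK -gpi_mul mulr1. Qed.
Fact gmulDl : left_distributive gmod_mul +%R.
Proof.
move=> x y z; rewrite -[x]lquot_reprK -[y]lquot_reprK -[z]lquot_reprK.
by rewrite -linearD -!gpi_mul -linearD mulrDl.
Qed.
Fact gmulDr : right_distributive gmod_mul +%R.
Proof.
move=> x y z; rewrite -[x]lquot_reprK -[y]lquot_reprK -[z]lquot_reprK.
by rewrite -linearD -!gpi_mul -linearD mulrDr.
Qed.

Let mcoeff1_rel u : grassmann_rel u -> mcoeff (@mone (word g)) u = 0.
Proof.
case=> [p q a x y|p q x]; rewrite !rmorphM /=.
  rewrite mcoeffB mcoeffD mcoeffZ /fgen !mcoeffU.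
  by rewrite !mulr0 addr0 subrr mulr0 mul0r.
by rewrite /fgen !mcoeffU !mulr0 mul0r.
Qed.

Let mcoeff1_linear :
  linear ((fun u : A => (mcoeff (@mone (word g)) u : K)) : A -> K^o).
Proof. by move=> a u v; rewrite mcoeffD mcoeffZ. Qed.

Fact gone_neq0 : gmod_one != 0.
Proof.
pose e u : K^o := mcoeff (@mone (word g)) u.
apply/eqP => /(congr1 (llift (q := the_lquotient grassmann_rel) e)).
rewrite -(linear0 pi) !(lliftE _ mcoeff1_linear mcoeff1_rel).
rewrite /e mcoeff1 eqxx mcoeff0.
by apply/eqP/oner_neq0.
Qed.

HB.instance Definition _ := GRing.Zmodule_isNzRing.Build grassmann_mod
  gmulA gmul1r gmulr1 gmulDl gmulDr gone_neq0.

Fact gscalerAl a (x y : grassmann_mod) : a *: (x * y) = (a *: x) * y.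
Proof.
rewrite -[x]lquot_reprK -[y]lquot_reprK -[_ * _ in LHS]gpi_mul -!linearZ /=.
by rewrite scalerAl gpi_mul.
Qed.
HB.instance Definition _ :=
  GRing.Lmodule_isLalgebra.Build K grassmann_mod gscalerAl.

Fact gscalerAr a (x y : grassmann_mod) : a *: (x * y) = x * (a *: y).
Proof.
rewrite -[x]lquot_reprK -[y]lquot_reprK -[_ * _ in LHS]gpi_mul -!linearZ /=.
by rewrite malg_scalerAr gpi_mul.
Qed.
HB.instance Definition _ :=
  GRing.Lalgebra_isAlgebra.Build K grassmann_mod gscalerAr.

Record grassmann_quotient := GrassmannQuotient {
  grassmann_type : algType K;
  grassmann_pi : {lrmorphism A -> grassmann_type};
  grassmann_repr : grassmann_type -> A;
  grassmann_reprK : cancel grassmann_repr grassmann_pi;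
  grassmann_piP : forall x y, grassmann_pi x = grassmann_pi y <-> I (x - y)
}.

(* The quotient of the free algebra by the ideal, opaque like the_lquotient. *)
Fact the_grassmann_quotient : grassmann_quotient.
Proof.
pose f : A -> grassmann_mod := pi.
have fl : linear f by exact: linearP.
pose N := GRing.isLinear.Build K A grassmann_mod _ f fl.
have fm : monoid_morphism f by split; [exact: erefl | exact: gpi_mul].
pose M := GRing.isMonoidMorphism.Build A grassmann_mod f fm.
pose p : {lrmorphism A -> grassmann_mod} := HB.pack f N M.
exact: (@GrassmannQuotient grassmann_mod p (@lquot_repr _ _ _ _)
  (@lquot_reprK _ _ _ _) (@lquot_piP _ _ _ _)).
Qed.

Definition grassmann : algType K := grassmann_type the_grassmann_quotient.
Definition grassmann_lquotient : lquotient grassmann_rel :=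
  @LQuotient _ _ _ grassmann (grassmann_pi _) (@grassmann_repr _)
    (@grassmann_reprK _) (@grassmann_piP _).
Local Notation gpi := (grassmann_pi the_grassmann_quotient).

Definition gin (x : g) : grassmann := gpi (fgen x).

Fact gin_linear : linear gin.
Proof.
move=> a x y; rewrite /gin -linearP; apply/grassmann_piP/lspan_gen.
by have := grassmann_rel_lin 1 1 a x y; rewrite mul1r mulr1.
Qed.
HB.instance Definition _ := GRing.isLinear.Build K g grassmann _ gin gin_linear.

Lemma gin_sq x : gin x * gin x = 0.
Proof.
rewrite -rmorphM -(rmorph0 gpi); apply/grassmann_piP/lspan_gen.
by have := grassmann_rel_sq 1 1 x; rewrite mul1r mulr1 subr0.
Qed.

Definition wedge (w : seq g) : grassmann := \prod_(x <- w) gin x.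

Lemma wedgeE (w : word g) : wedge w = gpi << w >>.
Proof.
rewrite /wedge; elim: w => [|x w IH]; first by rewrite big_nil -(rmorph1 gpi).
by rewrite big_cons IH -rmorphM malg_mulU.
Qed.

Lemma wedge0 : wedge [::] = 1. Proof. exact: big_nil. Qed.
Lemma wedge1 x : wedge [:: x] = gin x. Proof. exact: big_seq1. Qed.
Lemma wedge_cat u v : wedge (u ++ v) = wedge u * wedge v.
Proof. exact: big_cat. Qed.

Lemma grassmann_ext (W : lmodType K) (f h : grassmann -> W) :
  linear f -> linear h -> (forall w, f (wedge w) = h (wedge w)) -> f =1 h.
Proof.
move=> fl hl fh x; rewrite -[x]grassmann_reprK.
apply: (@malg_linear_ext K _ W (f \o gpi) (h \o gpi)).
- by move=> a y z /=; rewrite linearP fl.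
- by move=> a y z /=; rewrite linearP hl.
- by move=> w /=; rewrite -wedgeE.
Qed.

Lemma grassmann_rel_words (W : lmodType K) (f : A -> W) : linear f ->
  (forall u v a x y,
    f (<< u >> * (fgen (a *: x + y) - (a *: fgen x + fgen y)) * << v >>) = 0) ->
  (forall u v x, f (<< u >> * (fgen x * fgen x) * << v >>) = 0) ->
  forall r, grassmann_rel r -> f r = 0.
Proof.
move=> fl f1 f2.
have E r : (forall u v, f (<< u >> * r * << v >>) = 0) ->
    forall p q, f (p * r * q) = 0.
  move=> H p q.
  have f0 : f 0 = 0.
    by have := fl (-1) 0 0; rewrite scaler0 addr0 scaleN1r addNr.
  have Z : linear (fun=> 0 : W) by move=> H1 a x y; rewrite scaler0 addr0.
  have : (fun q => f (p * r * q)) =1 (fun=> 0).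
    apply: malg_linear_ext => // [a x y|v].
      by rewrite mulrDr -malg_scalerAr fl.
    have : (fun p => f (p * r * << v >>)) =1 (fun=> 0).
      apply: malg_linear_ext => // a x y.
      by rewrite mulrDl -scalerAl mulrDl -scalerAl fl.
    by apply.
  by apply.
by move=> r []; [move=> p q a x y; apply: E | move=> p q x; apply: E].
Qed.

(* The universal property: for h linear with h x * h x = 0, glift h is the
   algebra morphism extending h. *)
Section Lift.
Variables (B : algType K) (h : g -> B).

Definition glift : grassmann -> B :=
  llift (q := grassmann_lquotient) (lext (fun w => \prod_(x <- w) h x)).

Hypotheses (hl : linear h) (hsq : forall x, h x * h x = 0).

Let hR r : grassmann_rel r -> lext (fun w : word g => \prod_(x <- w) h x) r = 0.
Proof.
apply: grassmann_rel_words r => [|u v a x y|u v x]; first exact: lext_linear.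
  rewrite mulrBr mulrBl mulrDr mulrDl -malg_scalerAr -scalerAl !malg_mulU.
  rewrite linearB linearP /= !lextU !big_cat !big_seq1 /=.
  by rewrite hl mulrDr mulrDl -scalerAr -scalerAl subrr.
rewrite !malg_mulU lextU !big_cat !big_seq1 /= -!mulrA [h x * (h x * _)]mulrA.
by rewrite hsq mul0r mulr0.
Qed.

Lemma glift_linear : linear glift.
Proof. exact: (llift_linear (q := grassmann_lquotient) (lext_linear _) hR). Qed.

Lemma glift_wedge w : glift (wedge w) = \prod_(x <- w) h x.
Proof.
by rewrite wedgeE /glift lliftE ?lextU //; apply: lext_linear.
Qed.

Lemma glift_gin x : glift (gin x) = h x.
Proof. by rewrite -wedge1 glift_wedge big_seq1. Qed.

Lemma glift1 : glift 1 = 1.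
Proof. by rewrite -wedge0 glift_wedge big_nil. Qed.

Lemma gliftM : {morph glift : x y / x * y}.
Proof.
move=> x y; move: x; apply: (@grassmann_ext B (fun x => glift (x * y))
  (fun x => glift x * glift y)) => [a u v|a u v|u].
- by rewrite mulrDl -scalerAl glift_linear.
- by rewrite glift_linear mulrDl -scalerAl.
move: y; apply: (@grassmann_ext B (fun y => glift (wedge u * y))
  (fun y => glift (wedge u) * glift y)) => [a x y|a x y|v].
- by rewrite mulrDr -scalerAr glift_linear.
- by rewrite glift_linear mulrDr -scalerAr.
by rewrite -wedge_cat !glift_wedge big_cat.
Qed.
End Lift.

Definition ext_pow (k : nat) : grassmann -> Prop :=
  lspan (fun y => exists2 w : seq g, size w = k & y = wedge w).

(* gscale c is multiplication by c k on Lambda^k. *)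
Section GradedMap.
Variable (c : nat -> K).

Definition gscale : grassmann -> grassmann :=
  llift (q := grassmann_lquotient)
    (lext (fun w : word g => c (size w) *: wedge w)).

Let cR r : grassmann_rel r ->
  lext (fun w : word g => c (size w) *: wedge w) r = 0.
Proof.
apply: grassmann_rel_words r => [|u v a x y|u v x]; first exact: lext_linear.
  rewrite mulrBr mulrBl mulrDr mulrDl -malg_scalerAr -scalerAl !malg_mulU.
  rewrite linearB linearP /= !lextU !size_cat /= /wedge !big_cat !big_seq1 /=.
  rewrite scalerA mulrC -scalerA -scalerDr -scalerBr.
  by rewrite linearP mulrDr mulrDl -scalerAr -scalerAl subrr scaler0.
rewrite !malg_mulU lextU /wedge !big_cat !big_seq1 /= -!mulrA.
by rewrite [gin x * (gin x * _)]mulrA gin_sq mul0r mulr0 scaler0.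
Qed.

Fact gscale_linear : linear gscale.
Proof. exact: (llift_linear (q := grassmann_lquotient) (lext_linear _) cR). Qed.
HB.instance Definition _ :=
  GRing.isLinear.Build K grassmann grassmann _ gscale gscale_linear.

Lemma gscale_wedge w : gscale (wedge w) = c (size w) *: wedge w.
Proof. by rewrite {1}wedgeE /gscale lliftE ?lextU //; apply: lext_linear. Qed.
End GradedMap.

Lemma gscale_ext_pow c k x : ext_pow k x -> gscale c x = c k *: x.
Proof.
elim=> [|a u v [w <- ->] _ IH]; first by rewrite linear0 scaler0.
by rewrite gscale_linear IH gscale_wedge scalerDr !scalerA mulrC.
Qed.

Definition gpr : grassmann -> g :=
  llift (q := grassmann_lquotient)
    (lext (fun w : word g => if w is [:: x] then x else 0)).

Let gprR r : grassmann_rel r ->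
  lext (fun w : word g => if w is [:: x] then x else 0) r = 0.
Proof.
apply: grassmann_rel_words r => [|u v a x y|u v x]; first exact: lext_linear.
  rewrite mulrBr mulrBl mulrDr mulrDl -malg_scalerAr -scalerAl !malg_mulU.
  rewrite linearB linearP /= !lextU.
  by case: u => [|? [|? u]]; case: v => [|? v];
    rewrite /= ?scaler0 ?addr0 ?subrr.
by rewrite !malg_mulU lextU; case: u => [|? [|? u]].
Qed.

Fact gpr_linear : linear gpr.
Proof.
exact: (llift_linear (q := grassmann_lquotient) (lext_linear _) gprR).
Qed.
HB.instance Definition _ := GRing.isLinear.Build K grassmann g _ gpr gpr_linear.

Lemma gpr_wedge w : gpr (wedge w) = if w is [:: x] then x else 0.
Proof. by rewrite wedgeE /gpr lliftE ?lextU //; apply: lext_linear. Qed.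

Lemma gpr_gin x : gpr (gin x) = x.
Proof. by rewrite -wedge1 gpr_wedge. Qed.

End Grassmann.

Lemma linear_fun0 (K : fieldType) (V W : lmodType K) (f : V -> W) :
  linear f -> f 0 = 0.
Proof.
by move=> fl; have := fl (-1) 0 0; rewrite scaler0 addr0 scaleN1r addNr.
Qed.

Lemma linear_funZ (K : fieldType) (V W : lmodType K) (f : V -> W) a x :
  linear f -> f (a *: x) = a *: f x.
Proof. by move=> fl; have := fl a x 0; rewrite (linear_fun0 fl) !addr0. Qed.

Lemma linear_comb (K : fieldType) (V W : lmodType K) (f h : V -> W) (k : K) :
  linear f -> linear h -> linear (fun x => k *: f x + h x).
Proof.
by move=> fl hl a x y; rewrite fl hl !scalerDr addrACA !scalerA [k * a]mulrC.
Qed.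

Section TensorScale.
Variables (K : fieldType) (U V : lmodType K).
Implicit Types (u : U) (v : V).

Lemma tensZl a u v : (a *: u) ⊗ v = a *: (u ⊗ v).
Proof. exact: linear_funZ (tens_linearl v). Qed.

Lemma tensZr a u v : u ⊗ (a *: v) = a *: (u ⊗ v).
Proof. exact: linear_funZ (tens_linearr u). Qed.
End TensorScale.

Section GradedTensorSquare.
Variables (K : fieldType) (g : lmodType K).
Local Notation L := (grassmann g).

Definition grassmann2 : Type := tensor L L.
HB.instance Definition _ := GRing.Lmodule.on grassmann2.

Lemma grassmann2_ext (W : lmodType K) (f h : grassmann2 -> W) :
  linear f -> linear h ->
  (forall u v, f (wedge u ⊗ wedge v) = h (wedge u ⊗ wedge v)) -> f =1 h.
Proof.
move=> fl hl fh; apply: tensor_ext => // x y; move: x.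
apply: (@grassmann_ext K g W (fun x => f (x ⊗ y)) (fun x => h (x ⊗ y))).
- by move=> a x z; rewrite tens_linearl fl.
- by move=> a x z; rewrite tens_linearl hl.
move=> u; move: y; apply: (@grassmann_ext K g W (fun y => f (wedge u ⊗ y))
   (fun y => h (wedge u ⊗ y))) => //.
- by move=> a x z; rewrite tens_linearr fl.
- by move=> a x z; rewrite tens_linearr hl.
Qed.

(* The component of even (p = false) or odd (p = true) degree. *)
Definition gparity (p : bool) : L -> L := gscale (fun n => (odd n == p)%:R).
HB.instance Definition _ p := GRing.Linear.on (gparity p).

(* (a ⊗ b) (c ⊗ d) = (-1)^(deg b * deg c) (a c) ⊗ (b d), for b and c
   homogeneous. *)
Definition gmul2_tens (a b c d : L) : grassmann2 :=
  \sum_(p : bool) \sum_(q : bool)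
    (-1) ^+ (p && q) *: ((a * gparity p c) ⊗ (gparity q b * d)).
Definition gmul2 (s t : grassmann2) : grassmann2 :=
  tlift (fun a b => tlift (gmul2_tens a b) t) s.

Let sum_linear (F : bool -> bool -> L -> grassmann2) :
  (forall p q, linear (F p q)) ->
  linear (fun x => \sum_(p : bool) \sum_(q : bool) (-1) ^+ (p && q) *: F p q x).
Proof.
move=> Fl a x y; rewrite scaler_sumr -big_split; apply: eq_bigr => p _.
rewrite scaler_sumr -big_split; apply: eq_bigr => q _ /=.
by rewrite Fl scalerDr !scalerA mulrC.
Qed.

Let lin_a b c d : linear (fun a => gmul2_tens a b c d).
Proof.
by apply: sum_linear => p q k x y; rewrite mulrDl -scalerAl tens_linearl.
Qed.
Let lin_b a c d : linear (fun b => gmul2_tens a b c d).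
Proof.
apply: sum_linear => p q k x y.
by rewrite linearP mulrDl -scalerAl tens_linearr.
Qed.
Let lin_c a b d : linear (fun c => gmul2_tens a b c d).
Proof.
apply: sum_linear => p q k x y.
by rewrite linearP mulrDr -scalerAr tens_linearl.
Qed.
Let lin_d a b c : linear (gmul2_tens a b c).
Proof.
by apply: sum_linear => p q k x y; rewrite mulrDr -scalerAr tens_linearr.
Qed.

Let in_linear a b : linear (tlift (gmul2_tens a b)).
Proof. by apply: tlift_linear => [d|c]; [exact: lin_c | exact: lin_d]. Qed.

Let in_tens a b c d : tlift (gmul2_tens a b) (c ⊗ d) = gmul2_tens a b c d.
Proof. by apply: tlift_tens => [v|u]; [exact: lin_c | exact: lin_d]. Qed.

Let out_lina b t : linear (fun a => tlift (gmul2_tens a b) t).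
Proof.
move=> k x y; move: t; apply: tensor_ext => [||c d]; first exact: in_linear.
  exact: linear_comb (in_linear _ _) (in_linear _ _).
apply: (etrans (in_tens _ _ _ _)); apply: (etrans (lin_a _ _ _ _ _ _)).
by congr (_ *: _ + _); apply/esym/in_tens.
Qed.
Let out_linb a t : linear (fun b => tlift (gmul2_tens a b) t).
Proof.
move=> k x y; move: t; apply: tensor_ext => [||c d]; first exact: in_linear.
  exact: linear_comb (in_linear _ _) (in_linear _ _).
apply: (etrans (in_tens _ _ _ _)); apply: (etrans (lin_b _ _ _ _ _ _)).
by congr (_ *: _ + _); apply/esym/in_tens.
Qed.

Lemma gmul2_linearl t : linear (gmul2^~ t).
Proof.
by apply: tlift_linear => [b|a]; [exact: out_lina | exact: out_linb].
Qed.

Lemma gmul2E a b c d : gmul2 (a ⊗ b) (c ⊗ d) = gmul2_tens a b c d.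
Proof.
apply: (etrans _ (in_tens a b c d)).
by apply: tlift_tens => [y|x]; [exact: out_lina | exact: out_linb].
Qed.

Lemma gmul2_linearr s : linear (gmul2 s).
Proof.
move=> k x y; move: s; apply: tensor_ext => [||a b].
- exact: gmul2_linearl.
- exact: linear_comb (gmul2_linearl _) (gmul2_linearl _).
have E t : gmul2 (a ⊗ b) t = tlift (gmul2_tens a b) t.
  by apply: tlift_tens => [b'|a']; [exact: out_lina | exact: out_linb].
apply: (etrans (E _)); apply: (etrans (in_linear _ _ _ _ _)).
by congr (_ *: _ + _); apply/esym/E.
Qed.

Lemma gparity_wedge p w :
  gparity p (wedge w) = (odd (size w) == p)%:R *: wedge w.
Proof. exact: gscale_wedge. Qed.

Lemma gmul2_wedge (u v u' v' : seq g) :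
  gmul2 (wedge u ⊗ wedge v) (wedge u' ⊗ wedge v') =
  (-1) ^+ (size v * size u') *: (wedge (u ++ u') ⊗ wedge (v ++ v')).
Proof.
rewrite gmul2E /gmul2_tens !big_bool /= !gparity_wedge -!scalerAr -!scalerAl.
rewrite !tensZl !tensZr -!wedge_cat -[in RHS]signr_odd oddM.
case: (odd (size v)); case: (odd (size u'));
  by rewrite /= ?scale0r ?scaler0 ?scale1r ?add0r ?addr0.
Qed.

Lemma gmul2Zl s t a : gmul2 (a *: s) t = a *: gmul2 s t.
Proof. exact: linear_funZ (gmul2_linearl t). Qed.

Lemma gmul2Zr s t a : gmul2 s (a *: t) = a *: gmul2 s t.
Proof. exact: linear_funZ (gmul2_linearr s). Qed.

Definition gone2 : grassmann2 := 1 ⊗ 1.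

Fact gmul2A : associative gmul2.
Proof.
move=> x y z; move: x; apply: grassmann2_ext => [k x x'|k x x'|u v].
- exact: gmul2_linearl.
- by rewrite !gmul2_linearl.
move: y; apply: grassmann2_ext => [k y y'|k y y'|u' v'].
- by rewrite gmul2_linearl gmul2_linearr.
- by rewrite gmul2_linearr gmul2_linearl.
move: z; apply: grassmann2_ext => [k z z'|k z z'|u'' v''].
- by rewrite !gmul2_linearr.
- by rewrite !gmul2_linearr.
rewrite !gmul2_wedge gmul2Zr gmul2Zl !gmul2_wedge !scalerA -!exprD !catA.
congr (_ ^+ _ *: _); rewrite !size_cat mulnDl mulnDr.
lia.
Qed.

Fact gmul21r : left_id gone2 gmul2.
Proof.
have E : gone2 = wedge [::] ⊗ wedge [::] by rewrite wedge0.
apply: grassmann2_ext => [|//|u v]; first exact: gmul2_linearr.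
by rewrite E gmul2_wedge mul0n scale1r.
Qed.

Fact gmul2r1 : right_id gone2 gmul2.
Proof.
have E : gone2 = wedge [::] ⊗ wedge [::] by rewrite wedge0.
apply: grassmann2_ext => [|//|u v]; first exact: gmul2_linearl.
by rewrite E gmul2_wedge muln0 scale1r !cats0.
Qed.

Fact gmul2Dl : left_distributive gmul2 +%R.
Proof.
by move=> x y z; have := gmul2_linearl z 1 x y; rewrite !scale1r.
Qed.

Fact gmul2Dr : right_distributive gmul2 +%R.
Proof.
by move=> x y z; have := gmul2_linearr x 1 y z; rewrite !scale1r.
Qed.

Fact gone2_neq0 : gone2 != 0.
Proof.
pose e : L -> K^o := glift (fun=> 0).
pose z : g -> K^o := fun=> 0.
have zl : linear z by move=> a x y; rewrite scaler0 addr0.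
have zs (x : g) : z x * z x = 0 by rewrite mul0r.
have el : linear e by exact: (glift_linear zl zs).
have fl b : linear (fun a => e a * e b : K^o).
  by move=> k x y; rewrite el mulrDl -scalerAl.
have fr a : linear (fun b => e a * e b : K^o).
  by move=> k x y; rewrite el mulrDr -scalerAr.
apply/eqP => /(congr1 (tlift (fun a b => e a * e b : K^o))).
rewrite (tlift_tens fl fr) (linear_fun0 (tlift_linear fl fr)) /e.
by rewrite (glift1 zl zs) mulr1 => /eqP; rewrite oner_eq0.
Qed.

HB.instance Definition _ := GRing.Zmodule_isNzRing.Build grassmann2
  gmul2A gmul21r gmul2r1 gmul2Dl gmul2Dr gone2_neq0.

Fact gscaler2Al a (x y : grassmann2) : a *: (x * y) = (a *: x) * y.
Proof. by rewrite [RHS]gmul2Zl. Qed.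
HB.instance Definition _ :=
  GRing.Lmodule_isLalgebra.Build K grassmann2 gscaler2Al.
Fact gscaler2Ar a (x y : grassmann2) : a *: (x * y) = x * (a *: y).
Proof. by rewrite [RHS]gmul2Zr. Qed.
HB.instance Definition _ :=
  GRing.Lalgebra_isAlgebra.Build K grassmann2 gscaler2Ar.

(* The coproduct: the algebra morphism to the graded tensor square determined by
   its values on generators, see the lemmas below. *)
Definition gprimitive (x : g) : grassmann2 := 1 ⊗ gin x + gin x ⊗ 1.
Definition gcoprod : L -> tensor L L := glift gprimitive.

Fact gprimitive_linear : linear gprimitive.
Proof.
move=> a x y; rewrite /gprimitive linearP tens_linearl tens_linearr.
by rewrite scalerDr addrACA.
Qed.

Fact gprimitive_sq x : gprimitive x * gprimitive x = 0.
Proof.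
rewrite /gprimitive -wedge0 -wedge1 mulrDl !mulrDr.
rewrite -![_ * _]/(gmul2 _ _) !gmul2_wedge /= expr0 expr1 !scale1r scaleN1r.
have -> : wedge [:: x; x] = 0 :> L.
  by rewrite /wedge !big_cons big_nil mulr1 gin_sq.
by rewrite linear0 (linear_fun0 (tens_linearl _)) add0r addr0 addNr.
Qed.

Lemma gcoprod_linear : linear gcoprod.
Proof. exact: glift_linear gprimitive_linear gprimitive_sq. Qed.
Lemma gcoprod_gin x : gcoprod (gin x) = 1 ⊗ gin x + gin x ⊗ 1.
Proof. exact: glift_gin gprimitive_linear gprimitive_sq x. Qed.
Lemma gcoprod1 : gcoprod 1 = 1 ⊗ 1.
Proof. exact: (glift1 gprimitive_linear gprimitive_sq). Qed.
Lemma gcoprodM x y : gcoprod (x * y) = gmul2 (gcoprod x) (gcoprod y).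
Proof. exact: (gliftM gprimitive_linear gprimitive_sq). Qed.

End GradedTensorSquare.

Section GCBracket.
Variables (K : fieldType) (g : lmodType K).
Local Notation L := (grassmann g).

Definition grassmann_map (a : g -> g) : L -> L := glift (fun x => gin (a x)).

Definition gprod : tensor L L -> L := tlift (fun x y => x * y).

(* x |-> (-1)^(d * deg x) x *)
Definition koszul (d : int) : L -> L := gscale (fun k => (-1) ^ (d * k%:Z)).

Lemma koszulE d k x : ext_pow k x -> koszul d x = (-1) ^ (d * k%:Z) *: x.
Proof. exact: gscale_ext_pow. Qed.

(* The tensor product of phi and psi under the Koszul sign rule, for psi of
   degree d; it is tmap phi psi when d = 0. *)
Definition ktmap (d : int) (phi psi : L -> L) : tensor L L -> tensor L L :=
  tmap (fun x => phi (koszul d x)) psi.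

Variables alpha beta : g -> g.

Definition gtwist (p q : nat) : L -> L :=
  fun x => iter p (grassmann_map alpha) (iter q (grassmann_map beta) x).

(* phi : Lambda^i -> Lambda^j, extended by zero to the other degrees. *)
Definition gHom (i j : nat) (phi : L -> L) : Prop :=
  [/\ linear phi,
      forall x, ext_pow i x -> ext_pow j (phi x) &
      forall k x, k <> i -> ext_pow k x -> phi x = 0].

Definition gcB (i j : nat) (phi : L -> L) : Prop :=
  if (0 < i)%N && (0 < j)%N then
    [/\ gHom i j phi,
        forall x, ext_pow i x ->
          grassmann_map alpha (phi x) = phi (grassmann_map alpha x) &
        forall x, ext_pow i x ->
          grassmann_map beta (phi x) = phi (grassmann_map beta x)]
  else phi = 0.

(* psi o phi for psi in B^(k,l) and phi in B^(i,j); the maps tensored below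
   with tmap have a second factor of degree 0, so no sign arises there. *)
Definition gc_circ (k l i j : nat) (psi phi : L -> L) : L -> L :=
  let alpha_psi := gtwist k.-1 l.-1 in
  let alpha_phi := gtwist i.-1 j.-1 in
  gprod \o tmap psi alpha_psi \o tmap gprod id \o @tassoc K L L L
  \o tmap id (tmap (@gin K g \o @gpr K g) id) \o tmap id (@gcoprod K g)
  \o ktmap (j%:Z - i%:Z) alpha_phi phi \o @gcoprod K g.

(* An element of the direct sum of the B^(i,j) is the family of its
   components. *)
Definition gc_family := nat -> nat -> L -> L.
HB.instance Definition _ := GRing.Lmodule.on gc_family.

Definition gc_total (f : gc_family) : Prop :=
  (forall i j, gcB i j (f i j)) /\
  (exists N, forall i j, (N <= i)%N || (N <= j)%N -> f i j = 0).

Definition gc_homog (n : int) (f : gc_family) : Prop :=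
  gc_total f /\ forall i j : nat, j%:Z - i%:Z <> n -> f i j = 0.

Definition gc_hom_bracket (i j k l : nat) (phi psi : L -> L) : L -> L :=
  gc_circ i j k l phi psi
  - (-1) ^ ((j%:Z - i%:Z) * (l%:Z - k%:Z)) *: gc_circ k l i j psi phi.

(* Bilinear extension: as {B^(i,j), B^(k,l)} lies in B^(i+k-1,j+l-1), the
   (p,q) component sums over the indices with i + k = p + 1, j + l = q + 1. *)
Definition gc_bracket (f h : gc_family) : gc_family := fun p q =>
  \sum_(i < p.+2) \sum_(j < q.+2)
    gc_hom_bracket i j (p.+1 - i) (q.+1 - j)
      (f i j) (h (p.+1 - i)%N (q.+1 - j)%N).
End GCBracket.

Section GradedLie.
Variables (K : fieldType) (V : lmodType K).

Definition is_subspace (S : V -> Prop) : Prop :=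
  S 0 /\ forall (a : K) x y, S x -> S y -> S (a *: x + y).

(* The subspace A of V is the internal direct sum of the subspaces G n, and br
   restricts to a graded Lie bracket on A. *)
Record graded_lie_algebra (A : V -> Prop) (G : int -> V -> Prop)
    (br : V -> V -> V) : Prop := {
  gla_subspace : is_subspace A;
  gla_graded : forall n, is_subspace (G n);
  gla_sub : forall n x, G n x -> A x;
  gla_span : forall x, A x -> exists (s : seq int) (c : int -> V),
    (forall n, G n (c n)) /\ x = \sum_(n <- s) c n;
  gla_direct : forall (s : seq int) (c : int -> V), uniq s ->
    (forall n, G n (c n)) -> \sum_(n <- s) c n = 0 ->
    forall n, n \in s -> c n = 0;
  gla_linearl : forall (a : K) x y z, A x -> A y -> A z ->
    br (a *: x + y) z = a *: br x z + br y z;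
  gla_linearr : forall (a : K) x y z, A x -> A y -> A z ->
    br x (a *: y + z) = a *: br x y + br x z;
  gla_degree : forall m n x y, G m x -> G n y -> G (m + n) (br x y);
  gla_skew : forall m n x y, G m x -> G n y ->
    br x y = - ((-1) ^ (m * n) *: br y x);
  gla_jacobi : forall m n p x y z, G m x -> G n y -> G p z ->
    br x (br y z) = br (br x y) z + (-1) ^ (m * n) *: br y (br x z)
}.
End GradedLie.

(* Main.v *)
From HB Require Import structures.
Require Import Defs.
From mathcomp Require Import all_boot all_order all_algebra.
From mathcomp Require Import finmap boolp functions monalg zify ring.

(* Write D = (pr (x) id) Delta, so that phi o psi feeds one output of psi, picked
   by D, into phi. Coassociativity of Delta and the Leibniz rule for D give
     (phi o psi) o chi = C(phi, psi, chi) + S(phi; psi, chi),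
     phi o (psi o chi) = C(phi, psi, chi) + U(phi, psi; chi),
   where C is the chain chi -> psi -> phi, in S both psi and chi feed phi, and in
   U the outputs of chi feed both phi and psi. The twists by alpha and beta
   match because all maps commute with them and heights are additive. By graded
   cocommutativity S is graded symmetric in psi and chi; by cocommutativity and
   the antisymmetry of two successive contractions U is graded symmetric in phi
   and psi. Hence the associator S - U disappears from the graded alternating
   sum, which is the Jacobi identity. *)

Set Implicit Arguments.
Unset Strict Implicit.
Unset Printing Implicit Defensive.

Import GRing.Theory.
Local Open Scope ring_scope.

(** [S] is symmetric in its last two arguments and [U] in its first two, so neither pre-Lie identity
    is at hand: the product is only shown to be Lie-admissible, and the alternating sum over all six
    orders is needed, with six chains, three values of [S] and three of [U] as unknowns. The
    difficulty lies in the signs of the two symmetries. Each has four sources: the exchange of two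
    parts of the input, the exchange of two letters, which gives -1, the exchange of two blocks of
    outputs, and the Koszul operators. Their product is the expected sign only because a nonzero
    summand forces the degrees of the parts of the input to fit the source degrees of the maps. So
    each summand is first brought to a normal form free of signs, and the exponents are compared
    modulo 2 at the very end. As degrees matter only through their parity, the integer [j - i] is
    replaced by the natural number [i + j]. *)

Section LinearClosure.
Variable K : fieldType.

Lemma lin_id (U : lmodType K) : linear (fun x : U => x).
Proof. by []. Qed.

Lemma lin_comp (U V W : lmodType K) (f : V -> W) (h : U -> V) :
  linear f -> linear h -> linear (fun x => f (h x)).
Proof. by move=> fl hl a x y; rewrite hl fl. Qed.

Lemma lin_add (U W : lmodType K) (f h : U -> W) :
  linear f -> linear h -> linear (fun x => f x + h x).
Proof. by move=> fl hl a x y; rewrite fl hl scalerDr addrACA. Qed.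

Lemma lin_opp (U W : lmodType K) (f : U -> W) :
  linear f -> linear (fun x => - f x).
Proof. by move=> fl a x y; rewrite fl opprD scalerN. Qed.

Lemma lin_scale (U W : lmodType K) k (f : U -> W) :
  linear f -> linear (fun x => k *: f x).
Proof. by move=> fl a x y; rewrite fl scalerDr !scalerA mulrC. Qed.

Lemma lin_mull (U : lmodType K) (B : algType K) (f : U -> B) b :
  linear f -> linear (fun x => f x * b).
Proof. by move=> fl a x y; rewrite fl mulrDl -scalerAl. Qed.

Lemma lin_mulr (U : lmodType K) (B : algType K) (f : U -> B) b :
  linear f -> linear (fun x => b * f x).
Proof. by move=> fl a x y; rewrite fl mulrDr -scalerAr. Qed.

Lemma lin_funD (V W : lmodType K) (f : V -> W) x y :
  linear f -> f (x + y) = f x + f y.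
Proof. by move=> fl; have := fl 1 x y; rewrite !scale1r. Qed.

Lemma lin_funN (V W : lmodType K) (f : V -> W) x :
  linear f -> f (- x) = - f x.
Proof. by move=> fl; rewrite -scaleN1r (linear_funZ _ _ fl) scaleN1r. Qed.

Lemma lin_fun_sum (V W : lmodType K) (f : V -> W) I (r : seq I) P (F : I -> V) :
  linear f -> f (\sum_(i <- r | P i) F i) = \sum_(i <- r | P i) f (F i).
Proof.
move=> fl; apply: (big_morph f); first by move=> x y; apply: lin_funD.
exact: linear_fun0.
Qed.
End LinearClosure.

(** * Tensor lifts as finite sums *)

Section TliftSum.
Variables (K : fieldType) (U V : lmodType K).
Implicit Type t : tensor U V.

(** This holds by unfolding, with the chosen representative of [t]. It makes the rules on [F] below
    valid for functions that are not bilinear. *)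
Lemma tliftE (W : lmodType K) (F : U -> V -> W) t :
  tlift F t = \sum_(k <- msupp (lquot_repr t)) (lquot_repr t)@_k *: F k.1 k.2.
Proof. by []. Qed.

Lemma tlift_eq (W : lmodType K) (F G : U -> V -> W) t :
  (forall a b, F a b = G a b) -> tlift F t = tlift G t.
Proof. by move=> FG; rewrite !tliftE; apply: eq_bigr => k _; rewrite FG. Qed.

Lemma tlift_lin (W X : lmodType K) (f : W -> X) (F : U -> V -> W) t :
  linear f -> f (tlift F t) = tlift (fun a b => f (F a b)) t.
Proof.
move=> fl; rewrite !tliftE (lin_fun_sum _ _ _ fl).
by apply: eq_bigr => k _; rewrite (linear_funZ _ _ fl).
Qed.

Lemma tlift_param (W X : lmodType K) (F : X -> U -> V -> W) t :
  (forall a b, linear (fun z => F z a b)) -> linear (fun z => tlift (F z) t).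
Proof.
move=> Fl a x y; rewrite !tliftE scaler_sumr -big_split; apply: eq_bigr => k _ /=.
by rewrite Fl scalerDr !scalerA mulrC.
Qed.

Lemma tliftD (W : lmodType K) (F G : U -> V -> W) t :
  tlift (fun a b => F a b + G a b) t = tlift F t + tlift G t.
Proof.
by rewrite !tliftE -big_split; apply: eq_bigr => k _; rewrite scalerDr.
Qed.

(** Expands a composite of linear maps over the components of a coproduct; [gc_circE] uses it for
    both coproducts of the product. *)
Lemma tlift_linear_decomp (W : lmodType K) (f : tensor U V -> W) t :
  linear f -> f t = tlift (fun a b => f (a ⊗ b)) t.
Proof.
move=> fl.
have fA v : linear (fun u => f (u ⊗ v)).
  by move=> a x y; rewrite tens_linearl fl.
have fB u : linear (fun v => f (u ⊗ v)).
  by move=> a x y; rewrite tens_linearr fl.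
move: t; apply: tensor_ext => // [|u v]; first exact: tlift_linear.
by rewrite tlift_tens.
Qed.
End TliftSum.

Lemma tlift_exchange (K : fieldType) (U V U' V' W : lmodType K)
    (H : U -> V -> U' -> V' -> W) s t :
  tlift (fun a b => tlift (H a b) t) s =
  tlift (fun c d => tlift (fun a b => H a b c d) s) t.
Proof.
rewrite [RHS]tliftE [LHS]tliftE.
under eq_bigr do rewrite tliftE scaler_sumr.
under [RHS]eq_bigr do rewrite tliftE scaler_sumr.
rewrite exchange_big /=; apply: eq_bigr => k _; apply: eq_bigr => l _.
by rewrite !scalerA mulrC.
Qed.

Section TmapLinear.
Variable K : fieldType.

Lemma tmap_tens (U V U' V' : lmodType K) (f : U -> U') (h : V -> V') u v :
  linear f -> linear h -> tmap f h (u ⊗ v) = f u ⊗ h v.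
Proof.
move=> fl hl; rewrite /tmap tlift_tens // => [w|w] a x y.
  by rewrite fl tens_linearl.
by rewrite hl tens_linearr.
Qed.

Lemma tmap_linear (U V U' V' : lmodType K) (f : U -> U') (h : V -> V') :
  linear f -> linear h -> linear (tmap f h).
Proof.
move=> fl hl; apply: tlift_linear => [w|w] a x y.
  by rewrite fl tens_linearl.
by rewrite hl tens_linearr.
Qed.

Let tassoc_linr (U V W : lmodType K) (u : U) :
  linear (tlift (fun (v : V) (w : W) => u ⊗ v ⊗ w)).
Proof.
apply: tlift_linear => [w|v]; last exact: tens_linearr.
by move=> a x y; rewrite tens_linearr tens_linearl.
Qed.

Let tassoc_linl (U V W : lmodType K) t :
  linear (fun u : U => tlift (fun (v : V) (w : W) => u ⊗ v ⊗ w) t).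
Proof.
by apply: tlift_param => v w a x y; rewrite !tens_linearl.
Qed.

Lemma tassoc_linear (U V W : lmodType K) : linear (@tassoc K U V W).
Proof. by apply: tlift_linear => [t|u]; [exact: tassoc_linl|exact: tassoc_linr]. Qed.

Lemma tassoc_tens (U V W : lmodType K) (u : U) (v : V) (w : W) :
  tassoc (u ⊗ (v ⊗ w)) = u ⊗ v ⊗ w.
Proof.
rewrite /tassoc tlift_tens; [|exact: tassoc_linl|exact: tassoc_linr].
rewrite tlift_tens // => x; last exact: tens_linearr.
by move=> a y z; rewrite tens_linearr tens_linearl.
Qed.
End TmapLinear.

(** * Functoriality of the Grassmann algebra *)

Section GrassmannMap.
Variables (K : fieldType) (g : lmodType K).
Local Notation L := (grassmann g).
Implicit Types (h : {linear g -> g}) (x y : L) (v : g).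

Lemma wedge_cons v w : wedge (v :: w) = gin v * wedge w :> L.
Proof. exact: big_cons. Qed.

Lemma wedge_ind (W : lmodType K) (f h : L -> W) : linear f -> linear h ->
  f 1 = h 1 ->
  (forall v w, f (wedge w) = h (wedge w) ->
     f (gin v * wedge w) = h (gin v * wedge w)) ->
  f =1 h.
Proof.
move=> fl hl fh1 fhS; apply: grassmann_ext => //.
by elim=> [|v w IH]; rewrite ?wedge0 ?wedge_cons //; apply: fhS.
Qed.

Lemma ginC u v : gin u * gin v = - (gin v * gin u) :> L.
Proof.
have := gin_sq (u + v); rewrite linearD mulrDl !mulrDr !gin_sq add0r addr0.
by move/eqP; rewrite addr_eq0 => /eqP.
Qed.

Fact Lam_lin h : linear (fun v => gin (h v)).
Proof. by move=> a x y; rewrite !linearP. Qed.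

Fact Lam_sq h v : gin (h v) * gin (h v) = 0 :> L.
Proof. exact: gin_sq. Qed.

Lemma Lam_linear h : linear (grassmann_map h).
Proof. exact: glift_linear (Lam_lin h) (Lam_sq h). Qed.

Lemma Lam_gin h v : grassmann_map h (gin v) = gin (h v).
Proof. exact: glift_gin (Lam_lin h) (Lam_sq h) v. Qed.

Lemma Lam1 h : grassmann_map h 1 = 1.
Proof. exact: (glift1 (Lam_lin h) (Lam_sq h)). Qed.

Lemma LamM h x y : grassmann_map h (x * y) = grassmann_map h x * grassmann_map h y.
Proof. exact: (gliftM (Lam_lin h) (Lam_sq h)). Qed.

Lemma Lam_wedge h w : grassmann_map h (wedge w) = wedge (map h w).
Proof. by rewrite /grassmann_map (glift_wedge (Lam_lin h) (Lam_sq h)) /wedge big_map. Qed.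

Lemma Lam_comp (h h' : {linear g -> g}) x :
  grassmann_map h (grassmann_map h' x) = grassmann_map (h \o h') x.
Proof.
move: x; apply: grassmann_ext => [||w].
- exact: lin_comp (Lam_linear h) (Lam_linear h').
- exact: Lam_linear.
by rewrite !Lam_wedge -map_comp.
Qed.

Lemma eq_Lam (h h' : {linear g -> g}) : h =1 h' ->
  grassmann_map h =1 grassmann_map h'.
Proof.
move=> hh; apply: grassmann_ext => [||w]; try exact: Lam_linear.
by rewrite !Lam_wedge (eq_map hh).
Qed.

Lemma LamC (h h' : {linear g -> g}) x : (forall v, h (h' v) = h' (h v)) ->
  grassmann_map h (grassmann_map h' x) = grassmann_map h' (grassmann_map h x).
Proof. by move=> hh; rewrite !Lam_comp; apply: eq_Lam. Qed.

Definition sgn (d : int) : K := (-1) ^ d.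
Definition sscale (d : int) (v : g) : g := sgn d *: v.
Fact sscale_linear d : linear (sscale d).
Proof. exact: lin_scale (@lin_id _ _). Qed.
HB.instance Definition _ d :=
  GRing.isLinear.Build K g g _ (sscale d) (sscale_linear d).

(** The Koszul sign operator is the algebra morphism induced by a scalar map, so its
    multiplicativity and its compatibility with the coproduct come from the general rules for
    [grassmann_map]. *)
Lemma koszul_Lam d x : koszul d x = grassmann_map (sscale d) x.
Proof.
move: x; apply: grassmann_ext => [||w]; first exact: linearP.
  exact: Lam_linear.
rewrite Lam_wedge /koszul gscale_wedge; elim: w => [|v w IH].
  by rewrite mulr0 expr0z scale1r.
rewrite /= !wedge_cons linearZ /= -scalerAl -IH -scalerAr scalerA.
by rewrite /sgn -expfzDr ?oppr_eq0 ?oner_eq0 // intS mulrDr mulr1.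
Qed.

End GrassmannMap.

(** * Sweedler sums and contractions *)

Section Sweedler.
Variables (K : fieldType) (g : lmodType K).
Local Notation L := (grassmann g).

(* sw F x is the sum of the F(x_1, x_2) over the coproduct of x, and dd F x
   that of the F(pr x_1, x_2).  Both are finite weighted sums, hence linear in F
   without any condition; they are linear in x for bilinear F. *)
Definition sw (W : lmodType K) (F : L -> L -> W) (x : L) : W :=
  tlift F (gcoprod x).
Definition dd (W : lmodType K) (F : g -> L -> W) : L -> W :=
  sw (fun a b => F (gpr a) b).

Definition bilin (U V W : lmodType K) (F : U -> V -> W) : Prop :=
  (forall v, linear (F^~ v)) /\ (forall u, linear (F u)).

Lemma sw_linear (W : lmodType K) (F : L -> L -> W) : bilin F -> linear (sw F).
Proof.
by case=> Fl Fr; apply: lin_comp (@gcoprod_linear K g); apply: tlift_linear.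
Qed.

Lemma dd_linear (W : lmodType K) (F : g -> L -> W) : bilin F -> linear (dd F).
Proof.
case=> Fl Fr; apply: sw_linear; split=> [v|u]; last exact: Fr.
by apply: (lin_comp (Fl v)); apply: linearP.
Qed.

Lemma sw_param (W X : lmodType K) (F : X -> L -> L -> W) x :
  (forall a b, linear (fun z => F z a b)) -> linear (fun z => sw (F z) x).
Proof. exact: tlift_param. Qed.

Lemma dd_param (W X : lmodType K) (F : X -> g -> L -> W) x :
  (forall a b, linear (fun z => F z a b)) -> linear (fun z => dd (F z) x).
Proof. by move=> Fl; apply: tlift_param. Qed.

End Sweedler.

Definition trilin (K : fieldType) (U V W X : lmodType K)
    (G : U -> V -> W -> X) : Prop :=
  [/\ forall v w, linear (fun u => G u v w), forall u w, linear (G u ^~ w) &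
      forall u v, linear (G u v)].

(** Trying every hypothesis also catches linearity facts quantified over parameters, such as the two
    halves of [bilin]. *)
Ltac lin_head :=
  first [ assumption | exact: Lam_linear | exact: linearP
        | match goal with H : _ |- _ => solve [exact: H] end ].

Ltac lin_step :=
  cbv beta;
  lazymatch goal with
  | |- bilin _ => split
  | |- trilin _ => split
  | |- forall _, _ => intro
  | |- ?P => first
    [ assumption
    | exact: lin_id
    | match goal with
      | |- context [_ (sw ?F)] => refine (@sw_linear _ _ _ F _)
      | |- context [_ (dd ?F)] => refine (@dd_linear _ _ _ F _)
      end
    | match goal with
      | |- context [fun x => @?A x + @?B x] => refine (@lin_add _ _ _ A B _ _)
      | |- context [fun x => - (@?A x)] => refine (@lin_opp _ _ _ A _)
      | |- context [fun x => (@?A x) * ?b] => refine (@lin_mull _ _ _ A b _)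
      | |- context [fun x => ?b * (@?A x)] => refine (@lin_mulr _ _ _ A b _)
      | |- context [fun x => ?k *: (@?A x)] => refine (@lin_scale _ _ _ k A _)
      | |- context [fun x => sw ?F (@?A x)] =>
          refine (@lin_comp _ _ _ _ (sw F) A (@sw_linear _ _ _ F _) _)
      | |- context [fun x => dd ?F (@?A x)] =>
          refine (@lin_comp _ _ _ _ (dd F) A (@dd_linear _ _ _ F _) _)
      | |- context [fun x => sw (@?F x) ?y] =>
          refine (@sw_param _ _ _ _ F y _)
      | |- context [fun x => dd (@?F x) ?y] =>
          refine (@dd_param _ _ _ _ F y _)
      end
    | match goal with
      | |- context [fun x => ?f (@?A x)] =>
          refine (@lin_comp _ _ _ _ f A _ _); [ solve [lin_head] | ]
      | |- context [fun x => ?f (@?A x) ?b] =>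
          refine (@lin_comp _ _ _ _ (fun u => f u b) A _ _);
          [ solve [lin_head] | ]
      | |- context [fun x => ?f (@?A x) ?b ?c] =>
          refine (@lin_comp _ _ _ _ (fun u => f u b c) A _ _);
          [ solve [lin_head] | ]
      end
    | lin_head ]
  end.
(* Proves (bi-, tri-)linearity by descending to the place of the bound variable. *)
Ltac lin :=
  repeat match goal with
  | H : bilin _ |- _ => case: H => ? ?
  | H : trilin _ |- _ => case: H => ? ? ?
  end; repeat lin_step.

(** * Coproduct rules: letters, morphisms, coassociativity *)

Section SweedlerRules.
Variables (K : fieldType) (g : lmodType K).
Local Notation L := (grassmann g).
Local Notation sigma := (@koszul K g 1).
Implicit Types (h : {linear g -> g}) (x y : L) (u v : g).

Lemma sw_eq (W : lmodType K) (F G : L -> L -> W) x :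
  (forall a b, F a b = G a b) -> sw F x = sw G x.
Proof. exact: tlift_eq. Qed.

Lemma dd_eq (W : lmodType K) (F G : g -> L -> W) x :
  (forall v c, F v c = G v c) -> dd F x = dd G x.
Proof. by move=> FG; apply: tlift_eq. Qed.

Lemma sw_lin (W X : lmodType K) (f : W -> X) (F : L -> L -> W) x :
  linear f -> f (sw F x) = sw (fun a b => f (F a b)) x.
Proof. exact: tlift_lin. Qed.

Lemma dd_lin (W X : lmodType K) (f : W -> X) (F : g -> L -> W) x :
  linear f -> f (dd F x) = dd (fun v c => f (F v c)) x.
Proof. exact: tlift_lin. Qed.

Lemma swD (W : lmodType K) (F G : L -> L -> W) x :
  sw (fun a b => F a b + G a b) x = sw F x + sw G x.
Proof. exact: tliftD. Qed.

Lemma ddD (W : lmodType K) (F G : g -> L -> W) x :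
  dd (fun a b => F a b + G a b) x = dd F x + dd G x.
Proof. exact: tliftD. Qed.

Lemma ddN (W : lmodType K) (F : g -> L -> W) x :
  dd (fun a b => - F a b) x = - dd F x.
Proof. by symmetry; exact: (dd_lin F x (lin_opp (@lin_id _ _))). Qed.

Lemma ddZ (W : lmodType K) k (F : g -> L -> W) x :
  dd (fun a b => k *: F a b) x = k *: dd F x.
Proof. by symmetry; exact: (dd_lin F x (lin_scale k (@lin_id _ _))). Qed.

Lemma dd_eq0 (W : lmodType K) (F : g -> L -> W) x :
  (forall v c, F v c = 0) -> dd F x = 0.
Proof.
move=> F0; rewrite -[RHS](scale0r (dd F x)) -ddZ.
by apply: dd_eq => v c; rewrite scale0r.
Qed.

Lemma swZ (W : lmodType K) k (F : L -> L -> W) x :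
  sw (fun a b => k *: F a b) x = k *: sw F x.
Proof. by symmetry; exact: (sw_lin F x (lin_scale k (@lin_id _ _))). Qed.

Lemma ddM (F : g -> L -> L) y x : dd (fun a b => F a b * y) x = dd F x * y.
Proof. by symmetry; exact: (dd_lin F x (lin_mull y (@lin_id _ _))). Qed.

Lemma swM (F : L -> L -> L) y x : sw (fun a b => F a b * y) x = sw F x * y.
Proof. by symmetry; exact: (sw_lin F x (lin_mull y (@lin_id _ _))). Qed.

Lemma sw_dd_exchange (W : lmodType K) (H : L -> L -> g -> L -> W) x y :
  sw (fun a b => dd (H a b) y) x = dd (fun v c => sw (fun a b => H a b v c) x) y.
Proof. exact: tlift_exchange. Qed.

Lemma dd_exchange (W : lmodType K) (H : g -> L -> g -> L -> W) x y :
  dd (fun a b => dd (H a b) y) x = dd (fun v c => dd (fun a b => H a b v c) x) y.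
Proof. exact: tlift_exchange. Qed.

Lemma sigma_linear : linear sigma. Proof. exact: linearP. Qed.

Lemma sigma1 : sigma 1 = 1.
Proof. by rewrite koszul_Lam Lam1. Qed.

Lemma sigma_gin v : sigma (gin v) = - gin v.
Proof. by rewrite koszul_Lam Lam_gin /= /sscale /sgn expr1z scaleN1r linearN. Qed.

Lemma sigma_mul x y : sigma (x * y) = sigma x * sigma y.
Proof. by rewrite !koszul_Lam LamM. Qed.

Lemma sigma_wedge (w : seq g) : sigma (wedge w) = (-1) ^+ size w *: wedge w.
Proof. by rewrite /koszul gscale_wedge mul1r. Qed.

Lemma sigma_Lam h x : sigma (grassmann_map h x) = grassmann_map h (sigma x).
Proof. by rewrite !koszul_Lam; apply: LamC => v; rewrite /= /sscale linearZ. Qed.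

Lemma gpr1 : gpr 1 = 0 :> g.
Proof. by rewrite -wedge0 gpr_wedge. Qed.

Lemma gpr_sigma x : gpr (sigma x) = - gpr x.
Proof.
move: x; apply: grassmann_ext => [||w]; [by lin | by lin |].
rewrite sigma_wedge (linear_funZ _ _ (@gpr_linear K g)) gpr_wedge.
by case: w => [|x [|y w]]; rewrite ?scaler0 ?oppr0 //= expr1 scaleN1r.
Qed.

Lemma gpr_Lam h x : gpr (grassmann_map h x) = h (gpr x).
Proof.
move: x; apply: grassmann_ext => [||w]; [by lin | by lin |].
by rewrite Lam_wedge !gpr_wedge; case: w => [|x [|y w]]; rewrite ?linear0.
Qed.

Lemma gpr_gin2 u v x : gpr (gin u * (gin v * x)) = 0.
Proof.
move: x; apply: (grassmann_ext (h := fun=> 0)) => [||w]; first by lin.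
  by move=> a x y; rewrite scaler0 addr0.
by rewrite -!wedge_cons gpr_wedge.
Qed.

(** Only the degree-zero part of [x] survives the projection, and [sigma] fixes it. *)
Lemma gpr_gin_sigma u x : gpr (gin u * sigma x) = gpr (gin u * x).
Proof.
move: x; apply: wedge_ind => [|||v w _]; [by lin | by lin | |].
  by rewrite sigma1.
by rewrite sigma_mul sigma_gin mulNr mulrN linearN /= !gpr_gin2 oppr0.
Qed.

Lemma sw1 (W : lmodType K) (F : L -> L -> W) : bilin F -> sw F 1 = F 1 1.
Proof. by case=> ? ?; rewrite /sw gcoprod1 tlift_tens. Qed.

(** The coproduct is multiplicative and [v] is primitive; [sigma a] is the sign for moving [gin v]
    past [a]. The inductions on words below peel off letters with this rule. *)
Lemma sw_gin (W : lmodType K) (F : L -> L -> W) v x : bilin F ->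
  sw F (gin v * x) =
  sw (fun a b => F (gin v * a) b + F (sigma a) (gin v * b)) x.
Proof.
move=> FB; case: (FB) => Fl Fr; rewrite /sw gcoprodM gcoprod_gin.
have TF := tlift_linear Fl Fr.
move: (gcoprod x); apply: grassmann2_ext.
- by apply: (lin_comp TF); apply: gmul2_linearr.
- by apply: tlift_linear => [b|a]; lin.
move=> w w'; rewrite [RHS]tlift_tens; [|by lin|by lin].
rewrite gmul2Dl (lin_funD _ _ TF) -wedge0 -!wedge1 !gmul2_wedge /= -!wedge_cat /=.
rewrite mul0n mul1n scale1r !(linear_funZ _ _ TF) !tlift_tens // sigma_wedge.
by rewrite addrC (linear_funZ _ _ (Fl _)).
Qed.

(** Mirror rule, needed because the product appends the contracted letter on the right of the
    argument of [psi]. *)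
Lemma sw_ginr (W : lmodType K) (F : L -> L -> W) v x : bilin F ->
  sw F (x * gin v) =
  sw (fun a b => F a (b * gin v) + F (a * gin v) (sigma b)) x.
Proof.
move=> FB; have sl := sigma_linear; move: x F FB.
(* Passing to words first keeps [F] general in the induction, as peeling off a letter changes [F].
   The same reduction recurs below. *)
suff E w (F : L -> L -> W) : bilin F -> sw F (wedge w * gin v) =
    sw (fun a b => F a (b * gin v) + F (a * gin v) (sigma b)) (wedge w).
  by move=> x F FB; move: x; apply: grassmann_ext => [||w]; [lin|lin|apply: E].
elim: w F => [|u w IH] F FB.
  rewrite wedge0 mul1r -[gin v]mulr1 sw_gin // !sw1; [|by lin|by lin].
  by rewrite !mulr1 !mul1r !sigma1 addrC.
rewrite wedge_cons -mulrA !sw_gin //; last by lin.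
rewrite IH; last by lin.
apply: sw_eq => a b; case: (FB) => Fl Fr.
rewrite !sigma_mul !sigma_gin !mulrA !mulrN !mulNr !(lin_funN _ (Fr _)).
by rewrite !(lin_funN _ (Fl _)) addrACA.
Qed.

Lemma sw_Lam (W : lmodType K) (F : L -> L -> W) h x : bilin F ->
  sw F (grassmann_map h x) =
  sw (fun a b => F (grassmann_map h a) (grassmann_map h b)) x.
Proof.
move=> FB; have sl := sigma_linear; move: x F FB.
suff E w (F : L -> L -> W) : bilin F -> sw F (grassmann_map h (wedge w)) =
    sw (fun a b => F (grassmann_map h a) (grassmann_map h b)) (wedge w).
  by move=> x F FB; move: x; apply: grassmann_ext => [||w]; [lin|lin|apply: E].
elim: w F => [|u w IH] F FB.
  by rewrite wedge0 Lam1 !sw1 ?Lam1 //; lin.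
rewrite wedge_cons LamM Lam_gin !sw_gin //; last by lin.
rewrite IH; last by lin.
by apply: sw_eq => a b; rewrite !LamM !Lam_gin sigma_Lam.
Qed.

Lemma sw_coassoc (W : lmodType K) (G : L -> L -> L -> W) x : trilin G ->
  sw (fun a c => sw (fun a' b' => G a' b' c) a) x =
  sw (fun a c => sw (fun b' c' => G a b' c') c) x.
Proof.
move=> GB; have sl := sigma_linear; move: x G GB.
suff E w (G : L -> L -> L -> W) : trilin G ->
    sw (fun a c => sw (fun a' b' => G a' b' c) a) (wedge w) =
    sw (fun a c => sw (fun b' c' => G a b' c') c) (wedge w).
  by move=> x G GB; move: x; apply: grassmann_ext => [||w]; [lin|lin|apply: E].
elim: w G => [|u w IH] G GB.
  by rewrite wedge0 !sw1 //; lin.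
rewrite wedge_cons !sw_gin; [|by lin|by lin].
(* The first letter lands in one of three slots, with a [sigma] on each slot it passes; both
   bracketings reduce to the same [G']. *)
pose G' a b c := G (gin u * a) b c + G (sigma a) (gin u * b) c +
  G (sigma a) (sigma b) (gin u * c).
transitivity (sw (fun a c => sw (fun a' b' => G' a' b' c) a) (wedge w)).
  apply: sw_eq => a b; rewrite sw_gin; last by lin.
  by rewrite koszul_Lam sw_Lam -?swD; [|by lin]; apply: sw_eq => c d; rewrite -!koszul_Lam.
rewrite IH; last by rewrite /G'; lin.
apply: sw_eq => a b; rewrite sw_gin; last by lin.
by rewrite -swD; apply: sw_eq => c d; rewrite /G' addrA.
Qed.
End SweedlerRules.

(** * Homogeneous components, cocommutativity and contractions *)

Section ExteriorPower.
Variables (K : fieldType) (g : lmodType K).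
Local Notation L := (grassmann g).
Local Notation sigma := (@koszul K g 1).
Implicit Types (h : {linear g -> g}) (x y : L) (u v : g).

Lemma ext_pow_wedge (w : seq g) : ext_pow (size w) (wedge w).
Proof. by apply: lspan_gen; exists w. Qed.

Lemma ext_pow1 : ext_pow 0 (1 : L).
Proof. by rewrite -wedge0; apply: (ext_pow_wedge [::]). Qed.

Lemma ext_pow_gin v : ext_pow 1 (gin v).
Proof. by rewrite -wedge1; apply: (ext_pow_wedge [:: v]). Qed.

Lemma ext_pow_lin k (a : K) x y :
  ext_pow k x -> ext_pow k y -> ext_pow k (a *: x + y).
Proof. exact: lspan_linear. Qed.

Lemma ext_pow0 k : ext_pow k (0 : L).
Proof. exact: lspan_nil. Qed.

Lemma ext_powZ k (a : K) x : ext_pow k x -> ext_pow k (a *: x).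
Proof. by move=> xk; have := ext_pow_lin a xk (ext_pow0 k); rewrite addr0. Qed.

Lemma ext_pow_linear k (f : L -> L) j : linear f ->
  (forall w : seq g, size w = k -> ext_pow j (f (wedge w))) ->
  forall x, ext_pow k x -> ext_pow j (f x).
Proof.
move=> fl fw x; elim=> [|a u v [w wk ->] _ IH].
  by rewrite linear_fun0 //; apply: ext_pow0.
by rewrite fl; apply: ext_pow_lin => //; apply: fw.
Qed.

Lemma ext_pow_ext k (W : lmodType K) (f h : L -> W) : linear f -> linear h ->
  (forall w, size w = k -> f (wedge w) = h (wedge w)) ->
  forall x, ext_pow k x -> f x = h x.
Proof.
move=> fl hl fh x; elim=> [|a u v [w wk ->] _ IH].
  by rewrite !linear_fun0.
by rewrite fl hl IH fh.
Qed.

Lemma ext_powM k l x y : ext_pow k x -> ext_pow l y -> ext_pow (k + l) (x * y).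
Proof.
move=> xk yl; move: x xk; apply: (ext_pow_linear (f := fun x => x * y)) => [|w <-]; first by lin.
move: y yl; apply: (ext_pow_linear (f := fun y => _ * y)) => [|w' <-]; first by lin.
by rewrite -wedge_cat -size_cat; apply: ext_pow_wedge.
Qed.

Lemma ext_pow_Lam k h x : ext_pow k x -> ext_pow k (grassmann_map h x).
Proof.
move: x; apply: ext_pow_linear => [|w <-]; first by lin.
by rewrite Lam_wedge -(size_map h); apply: ext_pow_wedge.
Qed.

Lemma gin_mulC k v x : ext_pow k x -> x * gin v = (-1) ^+ k *: (gin v * x).
Proof.
move: x; apply: ext_pow_ext => [||w <-]; [by lin|by lin|].
elim: w => [|u w IH]; first by rewrite wedge0 mul1r mulr1 scale1r.
rewrite wedge_cons -mulrA IH -scalerAr !mulrA ginC mulNr scalerN.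
by rewrite /= exprS mulN1r scaleNr opprK.
Qed.

Lemma gin_mulAC x u v : x * gin u * gin v = - (x * gin v * gin u).
Proof. by rewrite -!mulrA ginC mulrN. Qed.

Lemma gmulC k l x y : ext_pow k x -> ext_pow l y ->
  x * y = (-1) ^+ (k * l) *: (y * x).
Proof.
move=> xk; move: y; apply: (ext_pow_ext (f := fun y => x * y)
  (h := fun y => _ *: (y * x))) => [||w <-]; [by lin|by lin|].
elim: w => [|u w IH]; first by rewrite wedge0 mul1r mulr1 muln0 scale1r.
rewrite wedge_cons mulrA (gin_mulC u xk) -scalerAl -!mulrA IH -scalerAr scalerA.
by rewrite mulnS exprD.
Qed.

Lemma sigma_hom k x : ext_pow k x -> sigma x = (-1) ^+ k *: x.
Proof. by move=> xk; rewrite (koszulE _ xk) mul1r. Qed.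

Lemma ext_pow_sigma k x : ext_pow k x -> ext_pow k (sigma x).
Proof. by rewrite koszul_Lam; apply: ext_pow_Lam. Qed.

(** The coproduct of a word of length [n] has components of total degree [n] only: each new letter
    raises exactly one of the two degrees. *)
Lemma sw_ext_hom n (W : lmodType K) (F G : L -> L -> W) x :
  bilin F -> bilin G -> ext_pow n x ->
  (forall k l a b, (k + l)%N = n -> ext_pow k a -> ext_pow l b -> F a b = G a b) ->
  sw F x = sw G x.
Proof.
move=> FB GB xn FG; move: x xn; apply: ext_pow_ext => [||w]; [by lin|by lin|].
have sl := @sigma_linear K g.
elim: w n F G FB GB FG => [|u w IH] n F G FB GB FG /= wn.
  rewrite wedge0 !sw1 //.
  by apply: (FG 0%N 0%N) => //; apply: ext_pow1.
rewrite wedge_cons !sw_gin //; apply: (IH n.-1); [by lin|by lin| |by rewrite -wn].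
move=> k l a b kl ak bl.
have uS m c : ext_pow m c -> ext_pow m.+1 (gin u * c).
  by move=> cm; exact: ext_powM (ext_pow_gin u) cm.
congr (_ + _); first by apply: (FG k.+1 l) => //; [rewrite addSn kl -wn | exact: uS].
apply: (FG k l.+1) => //; [by rewrite addnS kl -wn | exact: ext_pow_sigma | exact: uS].
Qed.

Lemma sw_ext (W : lmodType K) (F G : L -> L -> W) x : bilin F -> bilin G ->
  (forall k l a b, ext_pow k a -> ext_pow l b -> F a b = G a b) ->
  sw F x = sw G x.
Proof.
move=> FB GB FG; move: x; apply: grassmann_ext => [||w]; [by lin|by lin|].
apply: sw_ext_hom (ext_pow_wedge w) _ => // k l a b _; exact: FG.
Qed.

(** Graded cocommutativity. In the induction the two terms of [sw_gin] for [F] match those for [G]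
    in the opposite order, so the modified functions satisfy the same hypothesis. *)
Lemma sw_cocomm (W : lmodType K) (F G : L -> L -> W) x : bilin F -> bilin G ->
  (forall k l a b, ext_pow k a -> ext_pow l b ->
     F a b = (-1) ^+ (k * l) *: G b a) ->
  sw F x = sw G x.
Proof.
move=> FB GB FG; move: x; apply: grassmann_ext => [||w]; [by lin|by lin|].
have sl := @sigma_linear K g.
elim: w F G FB GB FG => [|u w IH] F G FB GB FG.
  rewrite wedge0 !sw1 //.
  by rewrite (FG 0%N 0%N) ?scale1r //; apply: ext_pow1.
rewrite wedge_cons !sw_gin //; apply: IH; [by lin|by lin|].
move=> k l a b ak bl.
have uS m c : ext_pow m c -> ext_pow m.+1 (gin u * c).
  by move=> cm; exact: ext_powM (ext_pow_gin u) cm.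
rewrite (FG _ _ _ _ (uS _ _ ak) bl) (FG _ _ _ _ (ext_pow_sigma ak) (uS _ _ bl)).
case: GB => Gl Gr.
rewrite (sigma_hom ak) (sigma_hom bl) (linear_funZ _ _ (Gl _)) (linear_funZ _ _ (Gr _)).
rewrite scalerDr addrC !scalerA -!exprD; congr (_ *: _ + _ *: _).
  by rewrite mulnS addnAC -[LHS]signr_odd !oddD addbb signr_odd.
by rewrite mulSn addnC.
Qed.

(** The projection only sees the degree-zero part of [a], so the sum collapses by the counit law. *)
Lemma sw_counit (W : lmodType K) (F : g -> L -> W) u x : bilin F ->
  sw (fun a b => F (gpr (gin u * a)) b) x = F u x.
Proof.
move=> FB; have sl := @sigma_linear K g; case: (FB) => Fl Fr.
move: x F FB Fl Fr.
suff E w (F : g -> L -> W) : bilin F ->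
    sw (fun a b => F (gpr (gin u * a)) b) (wedge w) = F u (wedge w).
  move=> x F FB Fl Fr; move: x.
  by apply: grassmann_ext => [||w]; [lin|lin|apply: E].
elim: w F => [|v w IH] F FB.
  by rewrite wedge0 sw1 ?mulr1 ?gpr_gin //; lin.
rewrite wedge_cons sw_gin; last by lin.
transitivity (sw (fun a b => F (gpr (gin u * a)) (gin v * b)) (wedge w)).
  apply: sw_eq => a b; case: (FB) => Fl _.
  by rewrite gpr_gin2 gpr_gin_sigma (linear_fun0 (Fl _)) add0r.
by rewrite (IH (fun v' b => F v' (gin v * b))) //; lin.
Qed.

Lemma dd1 (W : lmodType K) (F : g -> L -> W) : bilin F -> dd F 1 = 0.
Proof.
move=> FB; case: (FB) => Fl _.
by rewrite /dd sw1; [rewrite gpr1 (linear_fun0 (Fl _))|lin].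
Qed.

(** The letter picked is [u], by [sw_counit], or a letter of [x]; in the second case [sigma] acts on
    a factor seen in degree one, hence the minus sign. *)
Lemma dd_gin (W : lmodType K) (F : g -> L -> W) u x : bilin F ->
  dd F (gin u * x) = F u x - dd (fun v c => F v (gin u * c)) x.
Proof.
move=> FB; have sl := @sigma_linear K g; rewrite /dd sw_gin; last by lin.
rewrite swD sw_counit //; congr (_ + _); rewrite sw_lin; last by lin.
by apply: sw_eq => a b; case: FB => Fl _; rewrite gpr_sigma (lin_funN _ (Fl _)).
Qed.

(** Leibniz rule of an odd derivation: reaching a letter of [y] means passing [x]. *)
Lemma dd_mul (W : lmodType K) (F : g -> L -> W) x y : bilin F ->
  dd F (x * y) =
  dd (fun v c => F v (c * y)) x + dd (fun v c => F v (sigma x * c)) y.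
Proof.
move=> FB; have sl := @sigma_linear K g; move: x F FB.
suff E w (F : g -> L -> W) : bilin F -> dd F (wedge w * y) =
    dd (fun v c => F v (c * y)) (wedge w) +
    dd (fun v c => F v (sigma (wedge w) * c)) y.
  by move=> x F FB; move: x; apply: grassmann_ext => [||w]; [lin|lin|apply: E].
elim: w F => [|u w IH] F FB.
  rewrite wedge0 mul1r dd1; last by lin.
  by rewrite add0r; apply: dd_eq => v c; rewrite sigma1 mul1r.
rewrite wedge_cons -mulrA !dd_gin; [|by lin|by lin].
rewrite IH; last by lin.
rewrite opprD addrA; congr (_ - _ + _).
  by apply: dd_eq => v c; rewrite mulrA.
rewrite dd_lin; last by lin.
apply: dd_eq => v c; rewrite sigma_mul sigma_gin -mulrA mulNr.
by case: FB => _ Fr; rewrite (lin_funN _ (Fr _)).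
Qed.

Lemma dd_Lam (W : lmodType K) (F : g -> L -> W) h x : bilin F ->
  dd F (grassmann_map h x) = dd (fun v c => F (h v) (grassmann_map h c)) x.
Proof.
move=> FB; rewrite /dd sw_Lam; last by lin.
by apply: sw_eq => a b; rewrite gpr_Lam.
Qed.

(** Successive odd contractions anticommute. Two functions are compared because the exchange of
    letters also exchanges the two maps that receive them. *)
Lemma dd_anti (W : lmodType K) (G G' : g -> g -> L -> W) x :
  trilin G -> trilin G' -> (forall u v c, G u v c = - G' v u c) ->
  dd (fun u c => dd (G u) c) x = dd (fun u c => dd (G' u) c) x.
Proof.
move=> GB GB' GG; move: x G G' GB GB' GG.
suff E w (G G' : g -> g -> L -> W) : trilin G -> trilin G' ->
    (forall u v c, G u v c = - G' v u c) ->
    dd (fun u c => dd (G u) c) (wedge w) = dd (fun u c => dd (G' u) c) (wedge w).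
  move=> x G G' GB GB' GG; move: x.
  by apply: grassmann_ext => [||w]; [lin|lin|apply: E].
elim: w G G' => [|t w IH] G G' GB GB' GG.
  by rewrite wedge0 !dd1 //; lin.
rewrite wedge_cons !dd_gin; [|by lin|by lin].
have gE (H : g -> g -> L -> W) : trilin H ->
    dd (fun v c => dd (H v) (gin t * c)) (wedge w) =
    dd (fun v c => H v t c) (wedge w) -
    dd (fun v c => dd (fun v' c' => H v v' (gin t * c')) c) (wedge w).
  move=> HB; rewrite -ddN -ddD; apply: dd_eq => v c; by rewrite dd_gin //; lin.
rewrite !gE //.
(* Pairs of letters both taken from [w] are settled by induction; the remaining terms, where [t] is
   picked first or second, are matched crosswise. *)
rewrite (IH (fun u v c => G u v (gin t * c)) (fun u v c => G' u v (gin t * c)));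
  [|by lin|by lin|by move=> *; apply: GG].
rewrite !opprB !addrA [dd (G t) _ + _]addrC [dd (G' t) _ + _]addrC -!addrA.
congr (_ + _); rewrite -!ddN.
rewrite addrC; congr (_ + _); apply: dd_eq => v c; first by rewrite GG opprK.
exact: GG.
Qed.

Lemma dd_ext_hom n (W : lmodType K) (F G : g -> L -> W) x :
  bilin F -> bilin G -> ext_pow n x ->
  (forall v m c, n = m.+1 -> ext_pow m c -> F v c = G v c) -> dd F x = dd G x.
Proof.
move=> FB GB xn FG; move: x xn; apply: ext_pow_ext => [||w]; [by lin|by lin|].
elim: w n F G FB GB FG => [|u w IH] n F G FB GB FG /= wn.
  by rewrite wedge0 !dd1.
rewrite wedge_cons !dd_gin // (FG _ _ _ (esym wn) (ext_pow_wedge w)); congr (_ - _).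
apply: (IH n.-1); [by lin|by lin| |by rewrite -wn].
move=> v m c nm cm; apply: (FG v m.+1); first by rewrite -nm -wn.
exact: ext_powM (ext_pow_gin u) cm.
Qed.
End ExteriorPower.

(** Compares two powers of -1 by running through all parities of the atoms of their exponents. *)
Ltac parity :=
  rewrite -[LHS]signr_odd -[RHS]signr_odd /= ?(oddD, oddM) /= ?(oddD, oddM) /=;
  repeat match goal with |- context [odd ?n] => case: (odd n) end; by [].

(** * The two double compositions *)

Section Circ.
Variables (K : fieldType) (g : lmodType K).
Local Notation L := (grassmann g).
Local Notation sigma := (@koszul K g 1).
Local Notation Lam := (@grassmann_map K g).
Implicit Types (d : nat) (x y : L).

Lemma koszul_linear (d : int) : linear (@koszul K g d). Proof. exact: linearP. Qed.

Lemma koszul_hom d k x : ext_pow k x -> koszul d x = (-1) ^+ (d * k) *: x.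
Proof. by move=> xk; rewrite (koszulE _ xk). Qed.

Lemma koszulMn d d' x : koszul (d + d')%N x = koszul d (koszul d' x).
Proof.
move: x; apply: grassmann_ext => [||w]; [exact: koszul_linear| |].
  exact: lin_comp (koszul_linear d) (koszul_linear d').
have wk := ext_pow_wedge w; rewrite !(koszul_hom _ wk) (linear_funZ _ _ (koszul_linear _)).
by rewrite (koszul_hom _ wk) scalerA -exprD mulnDl addnC.
Qed.

Lemma koszul_LamC d (a : {linear g -> g}) x : koszul d (Lam a x) = Lam a (koszul d x).
Proof. by rewrite !koszul_Lam; apply: LamC => v; rewrite /= /sscale linearZ. Qed.

Lemma sw_koszul d (W : lmodType K) (F : L -> L -> W) x : bilin F ->
  sw F (koszul d x) = sw (fun a b => F (koszul d a) (koszul d b)) x.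
Proof.
move=> FB; rewrite koszul_Lam sw_Lam //.
by apply: sw_eq => a b; rewrite -!koszul_Lam.
Qed.

(** The product in Sweedler form: [v] is the output of [phi] fed to [psi], and [w] is what remains
    of that output. [d] has the parity of the degree of [phi]; [a] and [b] are the twists attached
    to [psi] and [phi]. *)
Definition circ (d : nat) (a b : g -> g) (psi phi : L -> L) (x : L) : L :=
  sw (fun y z => dd (fun v w =>
    psi (Lam b (koszul d y) * gin v) * Lam a w) (phi z)) x.

Section Associator.
Variables (a b c : {linear g -> g}) (phi psi chi : L -> L) (p q : nat).
Hypotheses (phil : linear phi) (psil : linear psi) (chil : linear chi).

(* chi feeds psi, which feeds phi *)
Definition chain x : L :=
  sw (fun y z => sw (fun y1 y2 => dd (fun u e =>
    dd (fun v w => phi (Lam b (koszul p (Lam c (koszul q y1))) * gin v) * Lam a w)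
      (psi (Lam c (koszul q y2) * gin u)) * Lam a (Lam b e)) (chi z)) y) x.

(* psi and chi both feed phi *)
Definition fork_in_summand y1 y2 z : L :=
  dd (fun u e => dd (fun v w =>
      phi (Lam b (koszul p (Lam c (koszul q y1) * gin u)) * gin v) * Lam a w)
    (psi (sigma (Lam c (koszul q y2)))) * Lam a (Lam b e)) (chi z).
Definition fork_in x : L :=
  sw (fun y z => sw (fun y1 y2 => fork_in_summand y1 y2 z) y) x.

(* chi feeds both phi and psi *)
Definition fork_out_summand y1 y2 z : L :=
  dd (fun u e => dd (fun v w => phi (Lam b (Lam c (koszul (p + q)%N y1)) * gin v) *
      Lam a (sigma (psi (Lam c (koszul q y2) * gin u)) * w)) (Lam b e)) (chi z).
Definition fork_out x : L :=
  sw (fun y1 y => sw (fun y2 z => fork_out_summand y1 y2 z) y) x.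

Lemma circ_linear d (h h' : {linear g -> g}) : linear (circ d h h' phi psi).
Proof. by have kl := koszul_linear; rewrite /circ; lin. Qed.

(** The inner composite receives [Lam c (koszul q y) * gin u]. By [sw_ginr] the letter [u] goes with
    the part given to [psi], which is the chain, or with the part given directly to [phi], which is
    the fork. *)
Lemma circ_circl x :
  circ q (a \o b) c (circ p a b phi psi) chi x = chain x + fork_in x.
Proof.
have kl := koszul_linear.
rewrite /circ /chain /fork_in /fork_in_summand -swD; apply: sw_eq => y z.
rewrite -swD; under [RHS]sw_eq do rewrite -ddD.
rewrite sw_dd_exchange; apply: dd_eq => u e.
rewrite sw_ginr; last by lin.
rewrite sw_Lam; last by lin.
rewrite sw_koszul; last by lin.
rewrite -swM.
by apply: sw_eq => y1 y2; rewrite mulrDl -Lam_comp.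
Qed.

(** [phi] picks its letter from an output of [psi] times the remaining outputs of [chi]. By [dd_mul]
    it comes from the first factor, which is the chain, or from the second, which is the fork. *)
Lemma circ_circr x :
  circ (p + q)%N a (b \o c) phi (circ q b c psi chi) x = chain x + fork_out x.
Proof.
have kl := koszul_linear.
rewrite /chain sw_coassoc; last by lin.
rewrite -swD /circ /fork_out_summand; apply: sw_eq => y1 y; rewrite -swD.
rewrite sw_lin; last by lin.
apply: sw_eq => y2 z; rewrite -ddD dd_lin; last by lin.
apply: dd_eq => u e; rewrite dd_mul; last by lin.
congr (_ + _); last by apply: dd_eq => v w; rewrite Lam_comp.
rewrite -ddM.
apply: dd_eq => v w.
by rewrite LamM mulrA koszulMn !koszul_LamC -Lam_comp.
Qed.
End Associator.
End Circ.

(** * Graded symmetry of the two forks *)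

Section Forks.
Variables (K : fieldType) (g : lmodType K).
Local Notation L := (grassmann g).
Local Notation Lam := (@grassmann_map K g).

Lemma gHom_linear i j (f : L -> L) : gHom i j f -> linear f.
Proof. by case. Qed.

Lemma gHom_eq0 i j (f : L -> L) k x : gHom i j f -> ext_pow k x -> k <> i -> f x = 0.
Proof. by move=> [_ _ f0] xk ki; apply: f0 xk. Qed.

Lemma gHom_ext_pow i j (f : L -> L) k x : gHom i j f -> ext_pow k x -> ext_pow j (f x).
Proof.
move=> fH xk; case: (eqVneq k i) => [ki|/eqP ki].
  by case: fH => _ fij _; apply: fij; rewrite -ki.
by rewrite (gHom_eq0 fH xk ki); apply: ext_pow0.
Qed.

Lemma fork_in_trilin (a b c : {linear g -> g}) (phi psi chi : L -> L) p q :
  linear phi -> linear psi -> linear chi ->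
  trilin (fork_in_summand a b c phi psi chi p q).
Proof.
by move=> ? ? ?; have kl := @koszul_linear K g; rewrite /fork_in_summand; lin.
Qed.

Lemma fork_out_trilin (a b c : {linear g -> g}) (phi psi chi : L -> L) p q :
  linear phi -> linear psi -> linear chi ->
  trilin (fork_out_summand a b c phi psi chi p q).
Proof.
by move=> ? ? ?; have kl := @koszul_linear K g; rewrite /fork_out_summand; lin.
Qed.

(** Coassociativity puts the last two slots under one coproduct, which is cocommutative. [r] is the
    sign left once that of the exchange is removed. *)
Lemma sw_sym23 (H1 H2 : L -> L -> L -> L) r x : trilin H1 -> trilin H2 ->
  (forall k1 k2 k3 x1 x2 x3, ext_pow k1 x1 -> ext_pow k2 x2 -> ext_pow k3 x3 ->
     H1 x1 x2 x3 = (-1) ^+ (k2 * k3 + r) *: H2 x1 x3 x2) ->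
  sw (fun y z => sw (fun y1 y2 => H1 y1 y2 z) y) x =
  (-1) ^+ r *: sw (fun y z => sw (fun y1 y2 => H2 y1 y2 z) y) x.
Proof.
move=> B1 B2 H12; rewrite !sw_coassoc // -swZ.
apply: sw_ext; [by lin|by lin|move=> k1 _ x1 y x1k _].
rewrite -swZ; apply: sw_cocomm; [by lin|by lin|move=> k2 k3 x2 x3 x2k x3k].
by rewrite (H12 _ _ _ _ _ _ x1k x2k x3k) exprD scalerA.
Qed.

Lemma sw_sym12 (H1 H2 : L -> L -> L -> L) r x : trilin H1 -> trilin H2 ->
  (forall k1 k2 k3 x1 x2 x3, ext_pow k1 x1 -> ext_pow k2 x2 -> ext_pow k3 x3 ->
     H1 x1 x2 x3 = (-1) ^+ (k1 * k2 + r) *: H2 x2 x1 x3) ->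
  sw (fun y1 y => sw (fun y2 z => H1 y1 y2 z) y) x =
  (-1) ^+ r *: sw (fun y1 y => sw (fun y2 z => H2 y1 y2 z) y) x.
Proof.
move=> B1 B2 H12; rewrite -!sw_coassoc // -swZ.
apply: sw_ext; [by lin|by lin|move=> _ k3 y x3 _ x3k].
rewrite -swZ; apply: sw_cocomm; [by lin|by lin|move=> k1 k2 x1 x2 x1k x2k].
by rewrite (H12 _ _ _ _ _ _ x1k x2k x3k) exprD scalerA.
Qed.

Section ForkIn.
Variables (phi psi chi : L -> L) (k l m n : nat).
Hypotheses (phil : linear phi) (psiH : gHom k l psi) (chiH : gHom m n chi).

(** The summand without signs and with [Lam c] moved out of [f], so that [f] and [h] play symmetric
    roles. *)
Let normal (a b c : {linear g -> g}) (f h : L -> L) x1 x2 x3 : L :=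
  dd (fun u e => dd (fun v w =>
    phi (Lam b (Lam c x1) * gin (b u) * gin (c v)) *
    (Lam a (Lam c w) * Lam a (Lam b e))) (f x2)) (h x3).

(** The exponent collects [koszul q] on [x1] and [x2], [koszul p] on a factor of degree [k1 + 1],
    and [sigma] on [x2]. *)
Let normalE (a b c : {linear g -> g}) (f h : L -> L) p q k1 k2 x1 x2 x3 :
  linear f -> linear h -> (forall x, f (Lam c x) = Lam c (f x)) ->
  ext_pow k1 x1 -> ext_pow k2 x2 ->
  fork_in_summand a b c phi f h p q x1 x2 x3 =
  (-1) ^+ (q * k1 + p * k1 + p + q * k2 + k2) *: normal a b c f h x1 x2 x3.
Proof.
move=> fl hl fc k1x k2x; rewrite /fork_in_summand /normal.
rewrite -ddZ; apply: dd_eq => u e.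
rewrite (koszul_hom _ k1x) (koszul_hom _ k2x) !(linear_funZ _ _ (Lam_linear _)).
rewrite -scalerAl !(linear_funZ _ _ (@koszul_linear K g _)).
rewrite (koszul_hom _ (ext_powM (ext_pow_Lam c k1x) (ext_pow_gin u))).
rewrite (sigma_hom (ext_pow_Lam c k2x)) !(linear_funZ _ _ fl) fc.
rewrite !(linear_funZ _ _ (@dd_linear _ _ _ _ _)); try by lin.
rewrite dd_Lam; last by lin.
rewrite -!scalerAl !scalerA.
rewrite -ddM.
rewrite -!ddZ.
apply: dd_eq => v w.
rewrite !(linear_funZ _ _ (Lam_linear _)) LamM Lam_gin.
rewrite -!scalerAl !(linear_funZ _ _ phil) -!scalerAl !scalerA -!exprD.
rewrite -[_ * _ * Lam a (Lam b e)]mulrA.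
congr (_ *: _); parity.
Qed.

Let swap_gin_mul r s x u v y z : ext_pow r y -> ext_pow s z ->
  phi (x * gin u * gin v) * (y * z) =
  (-1) ^+ (1 + r * s) *: (phi (x * gin v * gin u) * (z * y)).
Proof.
move=> yr zs; rewrite gin_mulAC (lin_funN _ phil) mulNr (gmulC yr zs).
by rewrite -scalerAr exprS mulN1r scaleNr.
Qed.

Let normal_eq0l (a b c : {linear g -> g}) (f h : L -> L) x1 x2 x3 :
  f x2 = 0 -> normal a b c f h x1 x2 x3 = 0.
Proof.
by move=> z; apply: dd_eq0 => u e; rewrite z; apply: linear_fun0; lin.
Qed.

Let normal_eq0r (a b c : {linear g -> g}) (f h : L -> L) x1 x2 x3 :
  h x3 = 0 -> normal a b c f h x1 x2 x3 = 0.
Proof.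
by move=> z; rewrite /normal z; apply: linear_fun0; lin.
Qed.

(** The two letters anticommute inside [phi], which gives the 1; after their removal [l.-1] and
    [n.-1] outputs are left to be exchanged. *)
Let normal_swap (a b c : {linear g -> g}) x1 x2 x3 :
  (0 < l)%N -> (0 < n)%N -> (forall v, a (b v) = b (a v)) ->
  (forall v, a (c v) = c (a v)) -> (forall v, b (c v) = c (b v)) ->
  ext_pow k x2 -> ext_pow m x3 ->
  normal a b c psi chi x1 x2 x3 =
  (-1) ^+ (1 + l.-1 * n.-1) *: normal a c b chi psi x1 x3 x2.
Proof.
move=> l0 n0 ab ac bc x2k x3m.
have psil := gHom_linear psiH; have chil := gHom_linear chiH.
apply: (etrans (dd_exchange _ _ _)); rewrite -ddZ.
apply: (dd_ext_hom _ _ (gHom_ext_pow psiH x2k)); [by lin|by lin|].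
move=> v l' w ll' wl; rewrite -ddZ.
apply: (dd_ext_hom _ _ (gHom_ext_pow chiH x3m)); [by lin|by lin|].
move=> u n' e nn' en; rewrite ll' nn' -[Lam c (Lam b x1)](LamC _ bc).
have yr := ext_pow_Lam a (ext_pow_Lam c wl).
have zs := ext_pow_Lam a (ext_pow_Lam b en).
exact: (swap_gin_mul (Lam b (Lam c x1)) (b u) (c v) yr zs).
Qed.

Lemma fork_in_sym (a b c : {linear g -> g}) x :
  (0 < l)%N -> (0 < n)%N -> (forall v, a (b v) = b (a v)) ->
  (forall v, a (c v) = c (a v)) -> (forall v, b (c v) = c (b v)) ->
  (forall x, psi (Lam c x) = Lam c (psi x)) ->
  (forall x, chi (Lam b x) = Lam b (chi x)) ->
  fork_in a b c phi psi chi (k + l) (m + n) x =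
  (-1) ^+ ((k + l) * (m + n)) *: fork_in a c b phi chi psi (m + n) (k + l) x.
Proof.
move=> l0 n0 ab ac bc psic chib.
have psil := gHom_linear psiH; have chil := gHom_linear chiH.
have B1 := fork_in_trilin a b c (k + l) (m + n) phil psil chil.
have B2 := fork_in_trilin a c b (m + n) (k + l) phil chil psil.
apply: (sw_sym23 _ B1 B2) => k1 k2 k3 x1 x2 x3 x1k x2k x3k.
rewrite (normalE _ _ _ _ _ psil chil psic x1k x2k).
rewrite (normalE _ _ _ _ _ chil psil chib x1k x3k).
(* Outside the source degrees of [psi] and [chi] both sides vanish. *)
case: (eqVneq k2 k) => [k2k|/eqP k2k]; last first.
  have z : psi x2 = 0 by apply: gHom_eq0 psiH x2k k2k.
  by rewrite normal_eq0l // normal_eq0r // !scaler0.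
case: (eqVneq k3 m) => [k3m|/eqP k3m]; last first.
  have z : chi x3 = 0 by apply: gHom_eq0 chiH x3k k3m.
  by rewrite normal_eq0r // normal_eq0l // !scaler0.
rewrite k2k in x2k *; rewrite k3m in x3k *.
rewrite normal_swap // !scalerA -!exprD; congr (_ *: _).
(* With [l] and [n] written as successors, their predecessors become atoms for [parity]. *)
move: l0 n0; case: l psiH => // l' _; case: n => // n' _ _ /=.
parity.
Qed.
End ForkIn.

Section ForkOut.
Variables (phi psi chi : L -> L) (i j k l : nat).
Hypotheses (phiH : gHom i j phi) (psiH : gHom k l psi) (chil : linear chi).

(** Here [Lam b] is pulled out of [f] together with the letter, so that both outputs stand side by
    side. *)
Let normal (a b c : {linear g -> g}) (f h : L -> L) x1 x2 x3 : L :=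
  dd (fun u e => dd (fun v w =>
    Lam b (f (Lam c x1 * gin v)) * Lam a (h (Lam c x2 * gin u)) *
    Lam a (Lam b w)) e) (chi x3).

Let normalE (a b c : {linear g -> g}) (f h : L -> L) m n p q k1 k2 x1 x2 x3 :
  linear f -> gHom m n h -> (forall x, f (Lam b x) = Lam b (f x)) ->
  ext_pow k1 x1 -> ext_pow k2 x2 ->
  fork_out_summand a b c f h chi p q x1 x2 x3 =
  (-1) ^+ ((p + q) * k1 + q * k2 + n) *: normal a b c f h x1 x2 x3.
Proof.
move=> fl hH fb k1x k2x; have hl := gHom_linear hH.
have sl := @sigma_linear K g.
rewrite /fork_out_summand /normal -ddZ; apply: dd_eq => u e.
rewrite dd_Lam; last by lin.
rewrite -ddZ; apply: dd_eq => v w.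
have hn := gHom_ext_pow hH (ext_powM (ext_pow_Lam c k2x) (ext_pow_gin u)).
rewrite (koszul_hom _ k1x) (koszul_hom _ k2x) !(linear_funZ _ _ (Lam_linear _)).
rewrite -!scalerAl (linear_funZ _ _ hl) (linear_funZ _ _ sl) (sigma_hom hn).
rewrite -!scalerAl !(linear_funZ _ _ (Lam_linear _)) (linear_funZ _ _ fl).
rewrite -(Lam_gin b v) -(LamM b) fb (LamM a) -scalerAl -!scalerAr !scalerA -!exprD.
rewrite -[in RHS]mulrA.
congr (_ *: _); parity.
Qed.

Let normal_eq0l (a b c : {linear g -> g}) (f h : L -> L) x1 x2 x3 :
  (forall v, f (Lam c x1 * gin v) = 0) -> normal a b c f h x1 x2 x3 = 0.
Proof.
move=> z; apply: dd_eq0 => u e; apply: dd_eq0 => v w.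
by rewrite z (linear_fun0 (Lam_linear _)) !mul0r.
Qed.

Let normal_eq0r (a b c : {linear g -> g}) (f h : L -> L) x1 x2 x3 :
  (forall v, h (Lam c x2 * gin v) = 0) -> normal a b c f h x1 x2 x3 = 0.
Proof.
move=> z; apply: dd_eq0 => u e; apply: dd_eq0 => v w.
by rewrite z (linear_fun0 (Lam_linear _)) mulr0 mul0r.
Qed.

(** The 1 comes from the two contractions of [chi x3], by [dd_anti], and [j * l] from exchanging the
    full outputs of [phi] and [psi]. *)
Let normal_swap (a b c : {linear g -> g}) k1 k2 x1 x2 x3 :
  (forall v, a (b v) = b (a v)) -> ext_pow k1 x1 -> ext_pow k2 x2 ->
  normal a b c phi psi x1 x2 x3 =
  (-1) ^+ (1 + j * l) *: normal b a c psi phi x2 x1 x3.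
Proof.
move=> ab x1k x2k.
have phil := gHom_linear phiH; have psil := gHom_linear psiH.
pose G' u v w := (-1) ^+ (1 + j * l) *: (Lam a (psi (Lam c x2 * gin v)) *
  Lam b (phi (Lam c x1 * gin u)) * Lam b (Lam a w)).
transitivity (dd (fun u e => dd (G' u) e) (chi x3)).
  apply: dd_anti; [by lin|by rewrite /G'; lin|move=> u v w].
  rewrite /G' exprS mulN1r scaleNr opprK (LamC w ab) scalerAl.
  congr (_ * _).
  have fj := gHom_ext_pow phiH (ext_powM (ext_pow_Lam c x1k) (ext_pow_gin v)).
  have hl := gHom_ext_pow psiH (ext_powM (ext_pow_Lam c x2k) (ext_pow_gin u)).
  exact: gmulC (ext_pow_Lam b fj) (ext_pow_Lam a hl).
rewrite /normal -ddZ; apply: dd_eq => u e.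
by rewrite -ddZ.
Qed.

Lemma fork_out_sym (a b c : {linear g -> g}) m n x :
  (forall v, a (b v) = b (a v)) ->
  (forall x, phi (Lam b x) = Lam b (phi x)) ->
  (forall x, psi (Lam a x) = Lam a (psi x)) ->
  fork_out a b c phi psi chi (k + l) (m + n) x =
  (-1) ^+ ((i + j) * (k + l)) *: fork_out b a c psi phi chi (i + j) (m + n) x.
Proof.
move=> ab phib psia.
have phil := gHom_linear phiH; have psil := gHom_linear psiH.
have B1 := fork_out_trilin a b c (k + l) (m + n) phil psil chil.
have B2 := fork_out_trilin b a c (i + j) (m + n) psil phil chil.
apply: (sw_sym12 _ B1 B2) => k1 k2 k3 x1 x2 x3 x1k x2k x3k.
rewrite (normalE _ _ _ _ _ phil psiH phib x1k x2k).
rewrite (normalE _ _ _ _ _ psil phiH psia x2k x1k).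
have gin_eq0 m' n' (f : L -> L) r (y : L) : gHom m' n' f -> ext_pow r y ->
    (r + 1)%N <> m' -> forall v, f (Lam c y * gin v) = 0.
  move=> fH yr rm v; apply: (gHom_eq0 fH _ rm).
  exact: ext_powM (ext_pow_Lam c yr) (ext_pow_gin v).
(* [phi] receives [x1] and one letter, so only [k1 + 1 = i] contributes; likewise [k2 + 1 = k] for
   [psi]. *)
case: (eqVneq (k1 + 1)%N i) => [k1i|/eqP k1i]; last first.
  have z := gin_eq0 _ _ _ _ _ phiH x1k k1i.
  by rewrite normal_eq0l // normal_eq0r // !scaler0.
case: (eqVneq (k2 + 1)%N k) => [k2k|/eqP k2k]; last first.
  have z := gin_eq0 _ _ _ _ _ psiH x2k k2k.
  by rewrite normal_eq0r // normal_eq0l // !scaler0.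
rewrite (normal_swap _ _ ab x1k x2k) !scalerA -!exprD -k1i -k2k; congr (_ *: _).
parity.
Qed.
End ForkOut.
End Forks.

(** * The composition product on homogeneous maps *)

Section GcCirc.
Variables (K : fieldType) (g : lmodType K).
Local Notation L := (grassmann g).
Local Notation Lam := (@grassmann_map K g).

Lemma int_signE (e : int) : (-1) ^ e = (-1) ^+ odd `|e| :> K.
Proof.
rewrite signr_odd; case: e => e //; rewrite NegzE abszN absz_nat.
by rewrite -exprnN -exprVn invrN1.
Qed.

(** Permits the replacement of the degree [j - i] by [i + j]. *)
Lemma koszul_parity (d d' : int) x : odd `|d| = odd `|d'| ->
  koszul d x = koszul d' x :> L.
Proof.
move=> dd'; move: x; apply: grassmann_ext => [||w]; [exact: koszul_linear..|].
rewrite !(koszulE _ (ext_pow_wedge w)) !int_signE !abszM !oddM.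
by rewrite dd'.
Qed.

Lemma eq_circ d d' (a a' b b' : {linear g -> g}) (psi phi : L -> L) x :
  odd d = odd d' -> a =1 a' -> b =1 b' ->
  circ d a b psi phi x = circ d' a' b' psi phi x.
Proof.
move=> dd' aa bb; apply: sw_eq => y z; apply: dd_eq => v w.
rewrite (eq_Lam aa) (eq_Lam bb).
by rewrite (koszul_parity (d := d) (d' := d')).
Qed.

Section Twist.
Variables alpha beta : {linear g -> g}.

Definition tw p q (v : g) : g := iter p alpha (iter q beta v).
Fact tw_linear p q : linear (tw p q).
Proof.
rewrite /tw => a x y.
have -> : iter q beta (a *: x + y) = a *: iter q beta x + iter q beta y.
  by elim: q => //= q ->; rewrite linearP.
by elim: p => //= p ->; rewrite linearP.
Qed.
HB.instance Definition _ p q :=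
  GRing.isLinear.Build K g g _ (tw p q) (tw_linear p q).

Lemma gtwistE p q x : gtwist alpha beta p q x = Lam (tw p q) x.
Proof.
rewrite /gtwist.
have -> : iter q (Lam beta) x = Lam (tw 0 q) x.
  elim: q => [|q IH] /=.
    move: x; apply: grassmann_ext => [||w]; [exact: lin_id|exact: Lam_linear|].
    by rewrite Lam_wedge map_id.
  by rewrite IH Lam_comp; apply: eq_Lam.
elim: p => [//|p IH] /=.
by rewrite IH Lam_comp; apply: eq_Lam.
Qed.

Lemma gc_circE k l i j (psi phi : L -> L) x : linear psi -> linear phi ->
  gc_circ alpha beta k l i j psi phi x =
  circ (i + j) (tw k.-1 l.-1) (tw i.-1 j.-1) psi phi x.
Proof.
move=> psil phil; rewrite /gc_circ /=.
set tpsi := gtwist _ _ _ _; set tphi := gtwist _ _ _ _.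
have tpsil : linear tpsi by move=> c y z; rewrite /tpsi !gtwistE Lam_linear.
have tphil : linear tphi by move=> c y z; rewrite /tphi !gtwistE Lam_linear.
have kl := @koszul_linear K g.
have gprl : linear (@gprod K g).
  by apply: tlift_linear => [y|y] c z t; rewrite ?mulrDl ?mulrDr -?scalerAl -?scalerAr.
have pl : linear (fun y : L => gin (gpr y)) by lin.
have idl : linear (@id L) by exact: lin_id.
have gcl := @gcoprod_linear K g.
have F1 := tmap_linear psil tpsil; have F2 := tmap_linear gprl idl.
have F3 := @tassoc_linear K L L L; have F4 := tmap_linear pl idl.
have F5 := tmap_linear idl F4; have F6 := tmap_linear idl gcl.
have F7 : linear (ktmap (j%:Z - i%:Z) tphi phi).
  by apply: tmap_linear => //; apply: lin_comp.
(* Everything that follows the second coproduct, kept as one linear map while the coproducts are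
   expanded. *)
pose R t := gprod (tmap psi tpsi (tmap (@gprod K g) id (tassoc (tmap id
   (tmap (@gin K g \o @gpr K g) id) t)))).
have Rl : linear R.
  exact: lin_comp gprl (lin_comp F1 (lin_comp F2 (lin_comp F3 F5))).
rewrite -[LHS]/(R (tmap id (@gcoprod K g) (ktmap (j%:Z - i%:Z) tphi phi (gcoprod x)))).
rewrite (tlift_linear_decomp _ (lin_comp Rl (lin_comp F6 F7))).
apply: tlift_eq => y z.
have -> : ktmap (j%:Z - i%:Z) tphi phi (y ⊗ z) =
    tphi (koszul (j%:Z - i%:Z) y) ⊗ phi z.
  by apply: tmap_tens => //; apply: lin_comp.
rewrite tmap_tens // (tlift_linear_decomp (gcoprod _) (lin_comp Rl (tens_linearr _))).
apply: tlift_eq => v w; rewrite /R (tmap_tens _ _ idl F4) (tmap_tens _ _ pl idl) tassoc_tens.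
rewrite tmap_tens // /gprod tlift_tens; [|by lin|by lin].
rewrite tmap_tens // tlift_tens; [|by lin|by lin].
rewrite /tpsi /tphi !gtwistE; congr (psi (Lam _ _ * _) * _).
apply: koszul_parity; lia.
Qed.
End Twist.
End GcCirc.

(** * Bidegree and equivariance of the product *)

Section Closure.
Variables (K : fieldType) (g : lmodType K).
Local Notation L := (grassmann g).
Local Notation Lam := (@grassmann_map K g).

Lemma lext_ext_pow r (f : word g -> L) (u : {malg K[word g]}) :
  (forall w, ext_pow r (f w)) -> ext_pow r (lext f u).
Proof.
move=> fr; rewrite /lext; elim: (enum_fset _) => [|w s IH].
  by rewrite big_nil; apply: ext_pow0.
by rewrite big_cons; apply: ext_pow_lin.
Qed.

(** The projection to degree [r] turns membership in an exterior power into an equation, to which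
    [sw_ext_hom] and [dd_ext_hom] apply. *)
Definition gcomp r : L -> L := gscale (fun n => (n == r)%:R).

Lemma gcomp_linear r : linear (gcomp r). Proof. exact: linearP. Qed.

Lemma gcomp_id r x : ext_pow r x -> gcomp r x = x.
Proof. by move=> xr; rewrite /gcomp (gscale_ext_pow _ xr) eqxx scale1r. Qed.

Lemma gcomp_ext_pow r x : ext_pow r (gcomp r x).
Proof.
apply: lext_ext_pow => w; case: eqP => [<-|_].
  by rewrite scale1r; apply: ext_pow_wedge.
by rewrite scale0r; apply: ext_pow0.
Qed.

Lemma sw_ext_pow n r (F : L -> L -> L) x : bilin F -> ext_pow n x ->
  (forall k l a b, (k + l)%N = n -> ext_pow k a -> ext_pow l b ->
     ext_pow r (F a b)) ->
  ext_pow r (sw F x).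
Proof.
move=> FB xn Fr; have cl := gcomp_linear r.
suff -> : sw F x = gcomp r (sw F x) by apply: gcomp_ext_pow.
rewrite (sw_lin F x cl).
apply: (sw_ext_hom _ _ xn) => [||k l a b kl ak bl]; [by []|by lin|].
by rewrite gcomp_id //; apply: Fr kl ak bl.
Qed.

Lemma dd_ext_pow n r (F : g -> L -> L) x : bilin F -> ext_pow n x ->
  (forall v m c, n = m.+1 -> ext_pow m c -> ext_pow r (F v c)) ->
  ext_pow r (dd F x).
Proof.
move=> FB xn Fr; have cl := gcomp_linear r.
suff -> : dd F x = gcomp r (dd F x) by apply: gcomp_ext_pow.
rewrite (dd_lin F x cl).
apply: (dd_ext_hom _ _ xn) => [||v m c nm cm]; [by []|by lin|].
by rewrite gcomp_id //; apply: Fr nm cm.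
Qed.

Lemma circ_gHom d (a b : {linear g -> g}) k l i j (psi phi : L -> L) :
  gHom k.+1 l.+1 psi -> gHom i.+1 j.+1 phi ->
  gHom (i + k).+1 (j + l).+1 (circ d a b psi phi).
Proof.
move=> psiH phiH; have psil := gHom_linear psiH; have phil := gHom_linear phiH.
have kl := @koszul_linear K g.
split=> [|x xn|n x nik xn]; first exact: circ_linear.
  apply: (sw_ext_pow _ xn) => [|k1 k2 y z k12 y1 z2]; first by lin.
  apply: (dd_ext_pow _ (gHom_ext_pow phiH z2)) => [|v m w [mj] wm]; first by lin.
  have yb := ext_pow_Lam b (ext_powZ ((-1) ^+ (d * k1)) y1).
  rewrite -(koszul_hom d y1) in yb.
  have := ext_powM (gHom_ext_pow psiH (ext_powM yb (ext_pow_gin v))) (ext_pow_Lam a wm).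
  by rewrite -mj addSn addnC.
(* Zero is written as a Sweedler sum, so that both sides can be compared bidegree by bidegree. *)
rewrite -[RHS](scale0r (circ d a b psi phi x)) -swZ.
apply: (sw_ext_hom _ _ xn) => [||k1 k2 y z k12 y1 z2]; [by lin|by lin|].
rewrite scale0r; case: (eqVneq k2 i.+1) => [k2i|/eqP k2i]; last first.
  by rewrite (gHom_eq0 phiH z2 k2i); apply: linear_fun0; lin.
apply: dd_eq0 => v w; rewrite (koszul_hom d y1).
have yb := ext_powM (ext_pow_Lam b (ext_powZ ((-1) ^+ (d * k1)) y1)) (ext_pow_gin v).
rewrite (gHom_eq0 psiH yb) ?mul0r // => k1k; apply: nik.
by rewrite -k12 k2i; lia.
Qed.

Lemma circ_LamC d (a b c : {linear g -> g}) (psi phi : L -> L) x :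
  linear psi -> linear phi ->
  (forall v, a (c v) = c (a v)) -> (forall v, b (c v) = c (b v)) ->
  (forall x, psi (Lam c x) = Lam c (psi x)) ->
  (forall x, phi (Lam c x) = Lam c (phi x)) ->
  circ d a b psi phi (Lam c x) = Lam c (circ d a b psi phi x).
Proof.
move=> psil phil ac bc psic phic; have kl := @koszul_linear K g.
rewrite /circ sw_Lam; last by lin.
rewrite (sw_lin _ _ (Lam_linear c)); apply: sw_eq => y z.
rewrite phic dd_Lam; last by lin.
rewrite (dd_lin _ _ (Lam_linear c)); apply: dd_eq => v w.
by rewrite LamM -psic LamM Lam_gin koszul_LamC (LamC _ bc) (LamC _ ac).
Qed.
End Closure.

(* An identity between linear combinations of v_0, .., v_11 holds in V as soon
   as it holds in K[X] with v_i replaced by X^i. *)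
Lemma lie_admissible (K : fieldType) (V : lmodType K) (e12 e13 e23 : bool)
    (C123 C132 C213 C231 C312 C321 S123 S213 S312 U123 U132 U231 : V) :
  let sg (b : bool) : K := (-1) ^+ b in
  let P123 := C123 + S123 in let P132 := C132 + sg e23 *: S123 in
  let P213 := C213 + S213 in let P231 := C231 + sg e13 *: S213 in
  let P312 := C312 + S312 in let P321 := C321 + sg e12 *: S312 in
  let Q123 := C123 + U123 in let Q213 := C213 + sg e12 *: U123 in
  let Q132 := C132 + U132 in let Q312 := C312 + sg e13 *: U132 in
  let Q231 := C231 + U231 in let Q321 := C321 + sg e23 *: U231 in
  Q123 - sg e23 *: Q132 - sg (e12 (+) e13) *: (P231 - sg e23 *: P321) =
  P123 - sg e12 *: P213 - sg (e13 (+) e23) *: (Q312 - sg e12 *: Q321)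
  + sg e12 *: (Q213 - sg e13 *: Q231 - sg (e12 (+) e23) *: (P132 - sg e13 *: P312)).
Proof.
pose vs := [:: C123; C132; C213; C231; C312; C321; S123; S213; S312; U123; U132; U231].
pose F (p : {poly K}) : V := \sum_(i < 12) p`_i *: nth 0 vs i.
have Fl : linear F.
  move=> a p q; rewrite /F scaler_sumr -big_split; apply: eq_bigr => i _ /=.
  by rewrite coefD coefZ scalerDl scalerA.
have FX i : (i < 12)%N -> nth 0 vs i = F 'X^i.
  move=> i12; rewrite /F (bigD1 (Ordinal i12)) //= coefXn eqxx scale1r.
  rewrite big1 ?addr0 // => k /negbTE ki; rewrite coefXn.
  by rewrite -[_ == i]/(k == Ordinal i12) ki scale0r.
move=> sg; cbv zeta.
rewrite (FX 0%N isT : C123 = _) (FX 1%N isT : C132 = _) (FX 2%N isT : C213 = _).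
rewrite (FX 3%N isT : C231 = _) (FX 4%N isT : C312 = _) (FX 5%N isT : C321 = _).
rewrite (FX 6%N isT : S123 = _) (FX 7%N isT : S213 = _) (FX 8%N isT : S312 = _).
rewrite (FX 9%N isT : U123 = _) (FX 10%N isT : U132 = _) (FX 11%N isT : U231 = _).
(* Each round moves [F] one level further out of the nested combinations. *)
rewrite -!(linear_funZ _ _ Fl) -!(lin_funD _ _ Fl) -!(linear_funZ _ _ Fl).
rewrite -!(lin_funN _ Fl) -!(lin_funD _ _ Fl) -!(linear_funZ _ _ Fl).
rewrite -!(lin_funN _ Fl) -!(lin_funD _ _ Fl) -(linear_funZ _ _ Fl) -(lin_funD _ _ Fl).
congr (F _); rewrite /sg -!mul_polyC; case: e12 e13 e23 => [] [] [];
  rewrite /= ?expr1 ?expr0 ?rmorphN ?rmorph1; ring.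
Qed.

(** [T] stands for maps bundled with their bidegree, which cannot be added; hence every hypothesis
    is an equation between values of [ev]. *)
Lemma lie_admissible_jacobi (K : fieldType) (V : lmodType K) (T : Type)
    (ev : T -> V) (o b : T -> T -> T) (deg : T -> bool) (C S U : T -> T -> T -> V) :
  let sg X Y : K := (-1) ^+ (deg X && deg Y) in
  (forall X Y, deg (b X Y) = deg X (+) deg Y) ->
  (forall X Y, ev (b X Y) = ev (o X Y) - sg X Y *: ev (o Y X)) ->
  (forall X Y Z, ev (o (b X Y) Z) = ev (o (o X Y) Z) - sg X Y *: ev (o (o Y X) Z)) ->
  (forall X Y Z, ev (o X (b Y Z)) = ev (o X (o Y Z)) - sg Y Z *: ev (o X (o Z Y))) ->
  (forall X Y Z, ev (o (o X Y) Z) = C X Y Z + S X Y Z) ->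
  (forall X Y Z, ev (o X (o Y Z)) = C X Y Z + U X Y Z) ->
  (forall X Y Z, S X Y Z = sg Y Z *: S X Z Y) ->
  (forall X Y Z, U X Y Z = sg X Y *: U Y X Z) ->
  forall X Y Z,
  ev (b X (b Y Z)) = ev (b (b X Y) Z) + sg X Y *: ev (b Y (b X Z)).
Proof.
move=> sg degb bE obl obr ol or SE UE X Y Z.
have sgE A B D : sg A (b B D) = (-1) ^+ ((deg A && deg B) (+) (deg A && deg D)).
  by rewrite /sg degb andb_addr.
have sgC A B : sg A B = sg B A by rewrite /sg andbC.
rewrite (bE X (b Y Z)) (bE (b X Y)) (bE Y (b X Z)) !obl !obr [sg (b X Y) Z]sgC !sgE.
rewrite !ol !or (SE X Z Y) (SE Y Z X) (SE Z Y X) (UE Y X Z) (UE Z X Y) (UE Z Y X).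
rewrite [sg Z Y]sgC [sg Z X]sgC [sg Y X]sgC ![deg Z && _]andbC [deg Y && deg X]andbC.
exact: lie_admissible.
Qed.

(** * Homogeneous maps bundled with their bidegree *)

Section Bihom.
Variables (K : fieldType) (g : lmodType K) (alpha beta : {linear g -> g}).
Hypothesis comm : forall v, alpha (beta v) = beta (alpha v).
Local Notation L := (grassmann g).
Local Notation Lam := (@grassmann_map K g).
Local Notation B := (gcB alpha beta).
Local Notation tw := (tw alpha beta).

Lemma iter_comm (T : Type) (f h : T -> T) p v : (forall v, f (h v) = h (f v)) ->
  f (iter p h v) = iter p h (f v).
Proof. by move=> fh; elim: p => //= p <-. Qed.

Lemma tw_comm (f : g -> g) p q v : (forall v, alpha (f v) = f (alpha v)) ->
  (forall v, beta (f v) = f (beta v)) -> tw p q (f v) = f (tw p q v).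
Proof.
move=> fa fb; rewrite /tw.
by rewrite -[iter q beta (f v)]iter_comm // -[iter p alpha (f _)]iter_comm.
Qed.

Lemma tw_alpha p q v : tw p q (alpha v) = alpha (tw p q v).
Proof. by apply: tw_comm => // w. Qed.

Lemma tw_beta p q v : tw p q (beta v) = beta (tw p q v).
Proof. by apply: tw_comm => // w. Qed.

Lemma twC p q p' q' v : tw p q (tw p' q' v) = tw p' q' (tw p q v).
Proof. by apply: tw_comm => w; rewrite ?tw_alpha ?tw_beta. Qed.

Lemma tw_add p q p' q' v : tw (p + p') (q + q') v = tw p q (tw p' q' v).
Proof.
rewrite /tw !iterD; congr (iter p _ _).
by apply: esym; apply: iter_comm => w; apply/esym; apply: iter_comm.
Qed.

(** Equivariance extends from the source degree to all elements, as both sides vanish in the other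
    degrees. *)
Lemma gcBP i j f : B i.+1 j.+1 f <->
  [/\ gHom i.+1 j.+1 f, forall x, f (Lam alpha x) = Lam alpha (f x) &
      forall x, f (Lam beta x) = Lam beta (f x)].
Proof.
rewrite /gcB /=; split=> [[fH fa fb]|[fH fa fb]]; last by split=> // x _.
have fl := gHom_linear fH.
have E (a : {linear g -> g}) :
    (forall x, ext_pow i.+1 x -> Lam a (f x) = f (Lam a x)) ->
    forall x, f (Lam a x) = Lam a (f x).
  move=> fE; apply: grassmann_ext => [||w]; [by lin|by lin|].
  have [wi|/eqP wi] := eqVneq (size w) i.+1.
    by rewrite fE // -wi; apply: ext_pow_wedge.
  have wk := ext_pow_wedge w.
  rewrite (gHom_eq0 fH wk wi) (gHom_eq0 fH (ext_pow_Lam a wk) wi).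
  by rewrite (linear_fun0 (Lam_linear _)).
by split=> //; apply: E.
Qed.

(** The stored indices are the height, which is additive under the product; shifting by one also
    leaves out the trivial spaces. *)
Record bihom := Bihom {
  hi : nat; hj : nat; hf :> L -> L; hfB : B hi.+1 hj.+1 hf }.
Implicit Types X Y Z : bihom.
Definition hdeg X := ((hi X).+1 + (hj X).+1)%N.

Lemma hfH X : gHom (hi X).+1 (hj X).+1 X.
Proof. by have /gcBP[] := hfB X. Qed.

Lemma hfl X : linear (hf X). Proof. exact: gHom_linear (hfH X). Qed.

Lemma hf_tw X p q x : X (Lam (tw p q) x) = Lam (tw p q) (X x).
Proof.
have /gcBP[_ fa fb] := hfB X; rewrite -!gtwistE /gtwist.
by rewrite iter_comm // iter_comm.
Qed.

Definition hcomp_fun (X Y : bihom) : L -> L :=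
  gc_circ alpha beta (hi X).+1 (hj X).+1 (hi Y).+1 (hj Y).+1 X Y.

Lemma hcomp_funE X Y x :
  hcomp_fun X Y x = circ (hdeg Y) (tw (hi X) (hj X)) (tw (hi Y) (hj Y)) X Y x.
Proof. exact: gc_circE (hfl X) (hfl Y). Qed.

Fact hcompB X Y : B (hi X + hi Y).+1 (hj X + hj Y).+1 (hcomp_fun X Y).
Proof.
have -> : hcomp_fun X Y = circ (hdeg Y) (tw (hi X) (hj X)) (tw (hi Y) (hj Y)) X Y.
  by apply/funext => x; apply: hcomp_funE.
have /gcBP[XH Xa Xb] := hfB X; have /gcBP[YH Ya Yb] := hfB Y.
apply/gcBP; split=> [|x|x].
- rewrite [(hi X + _)%N]addnC [(hj X + _)%N]addnC; exact: circ_gHom.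
- by apply: circ_LamC => // [||v|v]; try exact: hfl; exact: tw_alpha.
- by apply: circ_LamC => // [||v|v]; try exact: hfl; exact: tw_beta.
Qed.
Definition hcomp X Y : bihom := Bihom (hcompB X Y).

Definition hchain X Y Z : L -> L :=
  chain (tw (hi X) (hj X)) (tw (hi Y) (hj Y)) (tw (hi Z) (hj Z)) X Y Z (hdeg Y) (hdeg Z).
Definition hfork_in X Y Z : L -> L :=
  fork_in (tw (hi X) (hj X)) (tw (hi Y) (hj Y)) (tw (hi Z) (hj Z)) X Y Z (hdeg Y) (hdeg Z).
Definition hfork_out X Y Z : L -> L :=
  fork_out (tw (hi X) (hj X)) (tw (hi Y) (hj Y)) (tw (hi Z) (hj Z)) X Y Z (hdeg Y) (hdeg Z).

Lemma hcomp_l X Y Z x :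
  hcomp (hcomp X Y) Z x = hchain X Y Z x + hfork_in X Y Z x.
Proof.
rewrite /hchain /hfork_in -circ_circl; try exact: hfl.
apply: (etrans (hcomp_funE _ _ _)).
rewrite (eq_circ (a' := tw (hi X) (hj X) \o tw (hi Y) (hj Y))
  (b' := tw (hi Z) (hj Z)) (d' := hdeg Z)) //.
  apply: sw_eq => y z; apply: dd_eq => v w.
  by rewrite -hcomp_funE.
by move=> v; apply: tw_add.
Qed.

Lemma hcomp_r X Y Z x :
  hcomp X (hcomp Y Z) x = hchain X Y Z x + hfork_out X Y Z x.
Proof.
rewrite /hchain /hfork_out -circ_circr; try exact: hfl.
apply: (etrans (hcomp_funE _ _ _)).
rewrite (eq_circ (a' := tw (hi X) (hj X)) (b' := tw (hi Y) (hj Y) \o tw (hi Z) (hj Z))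
  (d' := (hdeg Y + hdeg Z)%N)) //.
- apply: sw_eq => y z.
  by rewrite -hcomp_funE.
(* The two numbers agree only modulo 2: [hdeg] of a composite is the sum minus two. *)
- by rewrite /hdeg /=; lia.
by move=> v; apply: tw_add.
Qed.

Lemma hfork_in_sym X Y Z x :
  hfork_in X Y Z x = (-1) ^+ (hdeg Y * hdeg Z) *: hfork_in X Z Y x.
Proof.
apply: (fork_in_sym (hfl X) (hfH Y) (hfH Z) x) => // [v|v|v|y|y];
  [exact: twC..|exact: hf_tw|exact: hf_tw].
Qed.

Lemma hfork_out_sym X Y Z x :
  hfork_out X Y Z x = (-1) ^+ (hdeg X * hdeg Y) *: hfork_out Y X Z x.
Proof.
apply: (fork_out_sym (hfH X) (hfH Y) (hfl Z)) => [v|y|y];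
  [exact: twC|exact: hf_tw|exact: hf_tw].
Qed.

End Bihom.

(** * The bracket of homogeneous maps *)

Section Bracket.
Variables (K : fieldType) (g : lmodType K) (alpha beta : {linear g -> g}).
Hypothesis comm : forall v, alpha (beta v) = beta (alpha v).
Local Notation L := (grassmann g).
Local Notation B := (gcB alpha beta).
Local Notation tw := (tw alpha beta).
Local Notation bihom := (bihom alpha beta).
Implicit Types X Y Z : bihom.

Lemma circ_linl d (a b : g -> g) (f h phi : L -> L) k x :
  circ d a b (fun y => k *: f y + h y) phi x =
  k *: circ d a b f phi x + circ d a b h phi x.
Proof.
rewrite -swZ -swD; apply: sw_eq => y z.
by rewrite -ddZ -ddD; apply: dd_eq => v w; rewrite mulrDl -scalerAl.
Qed.

(** Unlike in [circ_linl], the varying map supplies the element being contracted, so the contracted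
    function has to be bilinear. *)
Lemma circ_linr d (a b : {linear g -> g}) (psi f h : L -> L) k x : linear psi ->
  circ d a b psi (fun y => k *: f y + h y) x =
  k *: circ d a b psi f x + circ d a b psi h x.
Proof.
move=> psil; have kl := @koszul_linear K g.
rewrite -swZ -swD; apply: sw_eq => y z.
by apply: dd_linear; lin.
Qed.

Lemma gcB_linear i j f : B i j f -> linear f.
Proof.
rewrite /gcB; case: ifP => [_ [fH _ _]|_ ->]; first exact: gHom_linear fH.
by move=> a x y /=; rewrite scaler0 addr0.
Qed.

Lemma gcB0 i j : B i j 0.
Proof.
rewrite /gcB; case: ifP => // _; split=> [|x _|x _].
- split=> [a x y|x _|//]; first by rewrite /= scaler0 addr0.
  exact: ext_pow0.
- by apply: (linear_fun0 (Lam_linear alpha)).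
- by apply: (linear_fun0 (Lam_linear beta)).
Qed.

Lemma gcB_lin i j (a : K) (f h : L -> L) : B i j f -> B i j h -> B i j (a *: f + h).
Proof.
move=> fB hB; have fl := gcB_linear fB; have hl := gcB_linear hB.
move: fB hB; rewrite /gcB; case: ifP => [_|_ -> ->]; last by rewrite scaler0 addr0.
move=> [fH fa fb] [hH ha hb].
have E x : (a *: f + h) x = a *: f x + h x by [].
split=> [|x xi|x xi].
- split=> [|x xi|k x ki xk]; first by rewrite /=; exact: linear_comb.
    by rewrite E; apply: ext_pow_lin (gHom_ext_pow fH xi) (gHom_ext_pow hH xi).
  by rewrite E (gHom_eq0 fH xk ki) (gHom_eq0 hH xk ki) scaler0 addr0.
- by rewrite !E (Lam_linear alpha) fa // ha.
- by rewrite !E (Lam_linear beta) fb // hb.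
Qed.

Definition hsgn X Y : K :=
  (-1) ^ (((hj X).+1%:Z - (hi X).+1%:Z) * ((hj Y).+1%:Z - (hi Y).+1%:Z)).

Lemma hsgnE X Y : hsgn X Y = (-1) ^+ (odd (hdeg X) && odd (hdeg Y)).
Proof.
rewrite /hsgn int_signE /hdeg abszM oddM; congr (_ ^+ nat_of_bool (_ && _)); lia.
Qed.

Definition hbrk_fun X Y : L -> L :=
  gc_hom_bracket alpha beta (hi X).+1 (hj X).+1 (hi Y).+1 (hj Y).+1 X Y.

Lemma hbrk_funE X Y x :
  hbrk_fun X Y x = hcomp comm X Y x - hsgn X Y *: hcomp comm Y X x.
Proof. by []. Qed.

Fact hbrkB X Y : B (hi X + hi Y).+1 (hj X + hj Y).+1 (hbrk_fun X Y).
Proof.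
have -> : hbrk_fun X Y = - hsgn X Y *: hf (hcomp comm Y X) + hf (hcomp comm X Y).
  by rewrite scaleNr addrC.
apply: gcB_lin; last exact: hfB.
by rewrite [(hi X + _)%N]addnC [(hj X + _)%N]addnC; apply: hfB.
Qed.
Definition hbrk X Y : bihom := Bihom (hbrkB X Y).

Lemma hbrk_lin X Y :
  hbrk_fun X Y = fun x => - hsgn X Y *: hcomp comm Y X x + hcomp comm X Y x.
Proof. by apply/funext => x; rewrite hbrk_funE scaleNr addrC. Qed.

Lemma hcomp_brkl X Y Z x : hcomp comm (hbrk X Y) Z x =
  hcomp comm (hcomp comm X Y) Z x - hsgn X Y *: hcomp comm (hcomp comm Y X) Z x.
Proof.
rewrite -scaleNr [RHS]addrC; apply: (etrans (hcomp_funE _ _ _)).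
rewrite [hf _]hbrk_lin; apply: (etrans (circ_linl _ _ _ _ _ _ _ _)).
congr (_ *: _ + _); apply: esym; apply: (etrans (hcomp_funE _ _ _)); last by [].
by apply: eq_circ => // v; rewrite /= addnC [(hj Y + _)%N]addnC.
Qed.

Lemma hcomp_brkr X Y Z x : hcomp comm X (hbrk Y Z) x =
  hcomp comm X (hcomp comm Y Z) x - hsgn Y Z *: hcomp comm X (hcomp comm Z Y) x.
Proof.
rewrite -scaleNr [RHS]addrC; apply: (etrans (hcomp_funE _ _ _)).
rewrite [X in circ _ _ _ _ X](hbrk_lin Y Z : hf (hbrk Y Z) = _).
apply: (etrans (circ_linr _ _ _ _ _ _ _ (@hfl _ _ _ _ X))).
congr (_ *: _ + _); apply: esym; apply: (etrans (hcomp_funE _ _ _)); last by [].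
apply: eq_circ => // [|v]; first by rewrite /hdeg /=; lia.
by rewrite /= addnC [(hj Z + _)%N]addnC.
Qed.

Lemma hbrk_jacobi X Y Z x :
  hbrk X (hbrk Y Z) x = hbrk (hbrk X Y) Z x + hsgn X Y *: hbrk Y (hbrk X Z) x.
Proof.
rewrite hsgnE; pose deg (W : bihom) := odd (hdeg W).
apply: (@lie_admissible_jacobi K L bihom (fun W => hf W x) (hcomp comm) hbrk deg
  (fun X Y Z => hchain X Y Z x) (fun X Y Z => hfork_in X Y Z x)
  (fun X Y Z => hfork_out X Y Z x)) =>
  [X' Y'|X' Y'|X' Y' Z'|X' Y' Z'|X' Y' Z'|X' Y' Z'|X' Y' Z'|X' Y' Z'].
- by rewrite /deg /hdeg /=; lia.
- by rewrite -hsgnE.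
- by rewrite -hsgnE; apply: hcomp_brkl.
- by rewrite -hsgnE; apply: hcomp_brkr.
- exact: hcomp_l.
- exact: hcomp_r.
- by rewrite hfork_in_sym // -signr_odd oddM.
- by rewrite hfork_out_sym // -signr_odd oddM.
Qed.
End Bracket.

Lemma sum_if_eq (V : nmodType) N (c : nat -> V) a :
  \sum_(i < N) (if i == a :> nat then c i else 0) = if (a < N)%N then c a else 0.
Proof. by rewrite -big_mkcond big_ord1_eq. Qed.

Lemma sum2_if_eq (V : nmodType) N M (c : nat -> nat -> V) a b :
  \sum_(i < N) \sum_(j < M) (if (i == a :> nat) && (j == b :> nat) then c i j else 0) =
  if (a < N)%N && (b < M)%N then c a b else 0.
Proof.
under eq_bigr => i _.
  under eq_bigr do rewrite if_and.
  have -> : \sum_(j < M) (if i == a :> nat then if j == b :> nat then c i j else 0 else 0) =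
     if i == a :> nat then (if (b < M)%N then c i b else 0) else 0.
    by case: eqP => _; [exact: sum_if_eq | rewrite big1].
  over.
by rewrite (sum_if_eq N (fun i => if (b < M)%N then c i b else 0)) -if_and.
Qed.

Lemma linear_sub_scale (K : fieldType) (V : lmodType K) (a s : K) (u v w t : V) :
  a *: u + v - s *: (a *: w + t) = a *: (u - s *: w) + (v - s *: t).
Proof. by rewrite scalerBr !scalerDr opprD addrACA !scalerA mulrC. Qed.

(** * From homogeneous maps to families *)

Section AdditiveExtension.
Variables (K : fieldType) (V : lmodType K) (b : V -> V -> V).
(** [H n] is meant as the part of degree [n] and [S n] as a set of additive generators of it, which
    [H_ind] expresses. *)
Variables (H S : int -> V -> Prop).
Hypotheses (H0 : forall n, H n 0)
  (bH : forall m n x y, H m x -> H n y -> H (m + n) (b x y))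
  (bDl : forall n m x y z, H n x -> H n y -> H m z -> b (x + y) z = b x z + b y z)
  (bDr : forall n m x y z, H n x -> H n y -> H m z -> b z (x + y) = b z x + b z y)
  (SH : forall n x, S n x -> H n x)
  (H_ind : forall n (P : V -> Prop), P 0 ->
     (forall x y, H n x -> H n y -> P x -> P y -> P (x + y)) ->
     (forall x, S n x -> P x) -> forall x, H n x -> P x).

Let b0l m z : H m z -> b 0 z = 0.
Proof.
move=> zm; have := bDl (H0 0) (H0 0) zm.
by rewrite addr0 => /eqP; rewrite -subr_eq0 opprD addrA subrr add0r oppr_eq0 => /eqP.
Qed.

Let b0r m z : H m z -> b z 0 = 0.
Proof.
move=> zm; have := bDr (H0 0) (H0 0) zm.
by rewrite addr0 => /eqP; rewrite -subr_eq0 opprD addrA subrr add0r oppr_eq0 => /eqP.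
Qed.

Lemma skew_ext m n (s : K) :
  (forall x y, S m x -> S n y -> b x y = - (s *: b y x)) ->
  forall x y, H m x -> H n y -> b x y = - (s *: b y x).
Proof.
move=> Sskew x y xm yn; move: x xm; apply: (H_ind (n := m)).
- by rewrite (b0l yn) (b0r yn) scaler0 oppr0.
- move=> x x' xm x'm IH IH'.
  by rewrite (bDl xm x'm yn) (bDr xm x'm yn) IH IH' scalerDr opprD.
move=> x xS; have xm := SH xS.
move: y yn; apply: (H_ind (n := n)) => [|y y' yn y'n IH IH'|y yS].
- by rewrite (b0l xm) (b0r xm) scaler0 oppr0.
- by rewrite (bDl yn y'n xm) (bDr yn y'n xm) IH IH' scalerDr opprD.
exact: Sskew.
Qed.

Lemma jacobi_ext m n p (s : K) :
  (forall x y z, S m x -> S n y -> S p z ->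
     b x (b y z) = b (b x y) z + s *: b y (b x z)) ->
  forall x y z, H m x -> H n y -> H p z ->
  b x (b y z) = b (b x y) z + s *: b y (b x z).
Proof.
move=> Sjac; pose jac x y z := b x (b y z) = b (b x y) z + s *: b y (b x z).
have Dx x x' y z : H m x -> H m x' -> H n y -> H p z ->
    jac x y z -> jac x' y z -> jac (x + x') y z.
  move=> xm x'm yn zp IH IH'; rewrite /jac.
  rewrite (bDl xm x'm (bH yn zp)) IH IH' (bDl xm x'm yn) (bDl xm x'm zp).
  rewrite (bDl (bH xm yn) (bH x'm yn) zp).
  by rewrite (bDr (bH xm zp) (bH x'm zp) yn) scalerDr addrACA.
have Dy x y y' z : H m x -> H n y -> H n y' -> H p z ->
    jac x y z -> jac x y' z -> jac x (y + y') z.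
  move=> xm yn y'n zp IH IH'; rewrite /jac.
  rewrite (bDl yn y'n zp) (bDr (bH yn zp) (bH y'n zp) xm) IH IH'.
  rewrite (bDr yn y'n xm) (bDl (bH xm yn) (bH xm y'n) zp).
  by rewrite (bDl yn y'n (bH xm zp)) scalerDr addrACA.
have Dz x y z z' : H m x -> H n y -> H p z -> H p z' ->
    jac x y z -> jac x y z' -> jac x y (z + z').
  move=> xm yn zp z'p IH IH'; rewrite /jac.
  rewrite (bDr zp z'p yn) (bDr (bH yn zp) (bH yn z'p) xm) IH IH'.
  rewrite (bDr zp z'p (bH xm yn)) (bDr zp z'p xm).
  by rewrite (bDr (bH xm zp) (bH xm z'p) yn) scalerDr addrACA.
have jx0 y z : H n y -> H p z -> jac 0 y z.
  move=> yn zp; rewrite /jac (b0l (bH yn zp)) (b0l yn) (b0l zp) (b0r yn).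
  by rewrite scaler0 addr0.
have jy0 x z : H m x -> H p z -> jac x 0 z.
  move=> xm zp; rewrite /jac (b0l zp) (b0r xm) (b0l zp) (b0l (bH xm zp)).
  by rewrite scaler0 addr0.
have jz0 x y : H m x -> H n y -> jac x y 0.
  move=> xm yn; rewrite /jac (b0r yn) (b0r xm) (b0r (bH xm yn)) (b0r yn).
  by rewrite scaler0 addr0.
move=> x y z xm yn zp; move: x xm.
apply: (H_ind (n := m)) => [|x x' xm x'm|x xS]; [exact: jx0 | exact: Dx |].
have xm := SH xS; move: y yn.
apply: (H_ind (n := n)) => [|y y' yn y'n|y yS]; [exact: jy0 | exact: Dy |].
have yn := SH yS; move: z zp.
apply: (H_ind (n := p)) => [|z z' zp z'p|z zS]; [exact: jz0 | exact: Dz |].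
exact: Sjac.
Qed.
End AdditiveExtension.

(** * Finitely supported families and their bracket *)

Section Families.
Variables (K : fieldType) (g : lmodType K) (alpha beta : {linear g -> g}).
Hypothesis comm : forall v, alpha (beta v) = beta (alpha v).
Local Notation L := (grassmann g).
Local Notation B := (gcB alpha beta).
Local Notation tw := (tw alpha beta).
Local Notation bihom := (bihom alpha beta).
Local Notation F := (gc_family g).
Local Notation br := (gc_bracket alpha beta).
Local Notation total := (gc_total alpha beta).
Local Notation homog := (gc_homog alpha beta).
Local Notation hb := (gc_hom_bracket alpha beta).
Implicit Types (X Y Z : bihom) (x y z : F).

Lemma fam_sum I (r : seq I) (P : pred I) (f : I -> F) i j :
  (\sum_(n <- r | P n) f n) i j = \sum_(n <- r | P n) f n i j.
Proof. by apply: (big_morph (fun h : F => h i j)). Qed.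

Lemma total_subspace : is_subspace total.
Proof.
split=> [|a x y [xB [N xN]] [yB [M yM]]].
  by split=> [i j|]; [exact: gcB0 | exists 0%N].
split=> [i j|]; first exact: gcB_lin.
exists (maxn N M) => i j ij; have E : (a *: x + y) i j = a *: x i j + y i j by [].
by rewrite E xN ?yM ?scaler0 ?addr0 //; move: ij; rewrite !geq_max; lia.
Qed.

Lemma homog_subspace n : is_subspace (homog n).
Proof.
have [T0 TL] := total_subspace.
split=> [|a x y [xT xn] [yT yn]]; first by split.
split; first exact: TL.
move=> i j ij; have E : (a *: x + y) i j = a *: x i j + y i j by [].
by rewrite E xn // yn // scaler0 addr0.
Qed.

Lemma homogD n x y : homog n x -> homog n y -> homog n (x + y).
Proof. by have [_ HL] := homog_subspace n; move=> /HL xy /xy; move/(_ 1); rewrite scale1r. Qed.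

Lemma homog0 n : homog n 0.
Proof. by have [] := homog_subspace n. Qed.

Lemma gc_circ_linl k l i j (f h phi : L -> L) a :
  linear f -> linear h -> linear phi ->
  gc_circ alpha beta k l i j (a *: f + h) phi =
  a *: gc_circ alpha beta k l i j f phi + gc_circ alpha beta k l i j h phi.
Proof.
move=> fl hl pl; apply/funext => x.
rewrite (gc_circE _ _ _ _ _ _ _ (linear_comb a fl hl) pl).
apply: (etrans (circ_linl _ _ _ _ _ _ _ _)).
by rewrite -!gc_circE.
Qed.

Lemma gc_circ_linr k l i j (psi f h : L -> L) a :
  linear f -> linear h -> linear psi ->
  gc_circ alpha beta k l i j psi (a *: f + h) =
  a *: gc_circ alpha beta k l i j psi f + gc_circ alpha beta k l i j psi h.
Proof.
move=> fl hl pl; apply/funext => x.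
rewrite (gc_circE _ _ _ _ _ _ _ pl (linear_comb a fl hl)).
apply: (etrans (circ_linr _ _ _ _ _ _ _ pl)).
by rewrite -!gc_circE.
Qed.

Lemma hb_linl i j k l (f f' h : L -> L) a :
  linear f -> linear f' -> linear h ->
  hb i j k l (a *: f + f') h = a *: hb i j k l f h + hb i j k l f' h.
Proof.
move=> fl fl' hl; rewrite /gc_hom_bracket gc_circ_linl // gc_circ_linr //.
exact: linear_sub_scale.
Qed.

Lemma hb_linr i j k l (f f' h : L -> L) a :
  linear f -> linear f' -> linear h ->
  hb i j k l h (a *: f + f') = a *: hb i j k l h f + hb i j k l h f'.
Proof.
move=> fl fl' hl; rewrite /gc_hom_bracket gc_circ_linl // gc_circ_linr //.
exact: linear_sub_scale.
Qed.

Lemma fun0_linear : linear (0 : L -> L).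
Proof. by move=> a x y; rewrite /= scaler0 addr0. Qed.

Lemma hb0l i j k l h : linear h -> hb i j k l 0 h = 0.
Proof.
move=> hl; have := hb_linl i j k l (-1) fun0_linear fun0_linear hl.
by rewrite scaler0 addr0 scaleN1r addNr.
Qed.

Lemma hb0r i j k l h : linear h -> hb i j k l h 0 = 0.
Proof.
move=> hl; have := hb_linr i j k l (-1) fun0_linear fun0_linear hl.
by rewrite scaler0 addr0 scaleN1r addNr.
Qed.

Lemma total_linear x i j : total x -> linear (x i j).
Proof. by case=> xB _; apply: gcB_linear (xB i j). Qed.

Lemma br_linl a x y z : total x -> total y -> total z ->
  br (a *: x + y) z = a *: br x z + br y z.
Proof.
move=> xT yT zT; apply/funext => p; apply/funext => q.
have E : (a *: br x z + br y z) p q = a *: br x z p q + br y z p q by [].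
rewrite E /gc_bracket scaler_sumr -big_split; apply: eq_bigr => i _ /=.
rewrite scaler_sumr -big_split; apply: eq_bigr => j _ /=.
by apply: hb_linl; apply: total_linear.
Qed.

Lemma br_linr a x y z : total x -> total y -> total z ->
  br z (a *: x + y) = a *: br z x + br z y.
Proof.
move=> xT yT zT; apply/funext => p; apply/funext => q.
have E : (a *: br z x + br z y) p q = a *: br z x p q + br z y p q by [].
rewrite E /gc_bracket scaler_sumr -big_split; apply: eq_bigr => i _ /=.
rewrite scaler_sumr -big_split; apply: eq_bigr => j _ /=.
by apply: hb_linr; apply: total_linear.
Qed.

Lemma gcB_eq0 i j f : B i j f -> (i == 0)%N || (j == 0)%N -> f = 0.
Proof. by rewrite /gcB !lt0n -negb_or => fB ij; move: fB; rewrite ij. Qed.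

Lemma hbB i j k l p q (f h : L -> L) : B i j f -> B k l h ->
  (i + k)%N = p.+1 -> (j + l)%N = q.+1 -> B p q (hb i j k l f h).
Proof.
move=> fB hB ikp jlq; have fl := gcB_linear fB; have hl := gcB_linear hB.
(* An index 0 forces the map to vanish; otherwise all indices are successors and the maps can be
   bundled. *)
case ij: ((i == 0)%N || (j == 0)%N).
  by rewrite (gcB_eq0 fB ij) hb0l //; apply: gcB0.
case kl: ((k == 0)%N || (l == 0)%N).
  by rewrite (gcB_eq0 hB kl) hb0r //; apply: gcB0.
case: i ij fB ikp => // i; case: j jlq => // j; case: k kl hB => // k; case: l => // l.
rewrite !addSn !addnS => _ hB [<-] _ fB [<-].
exact: (hbrkB comm (Bihom fB) (Bihom hB)).
Qed.

Lemma br_homog m n x y : homog m x -> homog n y -> homog (m + n) (br x y).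
Proof.
move=> [[xB [N xN]] xm] [[yB [M yM]] yn].
have xl i j := gcB_linear (xB i j); have yl i j := gcB_linear (yB i j).
split; first split.
- move=> p q; rewrite /gc_bracket.
  apply: (big_ind (B p q)) => [|f h fB hB|i _]; first exact: gcB0.
    by rewrite -[f]scale1r; apply: gcB_lin.
  apply: (big_ind (B p q)) => [|f h fB hB|j _]; first exact: gcB0.
    by rewrite -[f]scale1r; apply: gcB_lin.
  (* The range gives [i <= p.+1], so the truncated subtraction is exact. *)
  by apply: hbB => //; rewrite subnKC // -ltnS.
(* If [i] and [j] are both below [N], one of the complementary indices is at least [M]. *)
- exists (N + M)%N => p q pq; rewrite /gc_bracket; apply: big1 => i _; apply: big1 => j _.
  have [Ni|Ni] := boolP ((N <= i)%N || (N <= j)%N); first by rewrite xN // hb0l.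
  rewrite yM ?hb0r //; have := ltn_ord i; have := ltn_ord j; move: pq Ni; lia.
move=> p q pq; rewrite /gc_bracket; apply: big1 => i _; apply: big1 => j _.
have [ij|/eqP ij] := eqVneq (j%:Z - i%:Z) m; last by rewrite xm // hb0l.
rewrite yn ?hb0r // => kl; apply: pq; rewrite -ij -kl.
have := ltn_ord i; have := ltn_ord j; lia.
Qed.

Definition single X : F := fun i j =>
  if (i == (hi X).+1) && (j == (hj X).+1) then hf X else 0.

Lemma single_homog X n : (hj X)%:Z - (hi X)%:Z = n -> homog n (single X).
Proof.
move=> Xn; split; first split.
- move=> i j; rewrite /single; case: ifP => [/andP[/eqP-> /eqP->]|_].
    exact: hfB.
  exact: gcB0.
- exists (hi X + hj X).+2 => i j ij; rewrite /single; case: ifP => // /andP[/eqP Ei /eqP Ej].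
  move: ij; rewrite Ei Ej; lia.
move=> i j ij; rewrite /single; case: ifP => // /andP[/eqP Ei /eqP Ej].
by case: ij; rewrite Ei Ej; lia.
Qed.

Lemma br_single X Y : br (single X) (single Y) = single (hbrk comm X Y).
Proof.
apply/funext => p; apply/funext => q; rewrite /gc_bracket.
pose c (i j : nat) := hb i j (p.+1 - i) (q.+1 - j) X (single Y (p.+1 - i)%N (q.+1 - j)%N).
(* Only the term at the indices of [X] can survive, and its other factor vanishes unless the
   complementary indices are those of [Y]. *)
transitivity (\sum_(i < p.+2) \sum_(j < q.+2)
  if (i == (hi X).+1 :> nat) && (j == (hj X).+1 :> nat) then c i j else 0).
  apply: eq_bigr => i _; apply: eq_bigr => j _; rewrite /single.
  case: ifP => // _; apply: hb0l; case: ifP => _; [exact: hfl | exact: fun0_linear].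
rewrite sum2_if_eq /c /single !subSS /=.
have [/andP[/eqP pE /eqP qE]|pq] := boolP ((p == (hi X + hi Y).+1) && _).
  have -> : (p - hi X)%N = (hi Y).+1 by lia.
  have -> : (q - hj X)%N = (hj Y).+1 by lia.
  by rewrite !eqxx ifT //; lia.
case: ifP => // /andP[Xp Xq]; case: ifP => [/andP[/eqP Yp /eqP Yq]|_]; last exact: hb0r (hfl X).
by case/negP: pq; move: Xp Xq Yp Yq; lia.
Qed.

Lemma homog_ind n (P : F -> Prop) : P 0 ->
  (forall x y, homog n x -> homog n y -> P x -> P y -> P (x + y)) ->
  (forall X, (hj X)%:Z - (hi X)%:Z = n -> P (single X)) ->
  forall x, homog n x -> P x.
Proof.
move=> P0 PD PS x [[xB [N xN]] xn].
pose comp (i j : nat) : F := fun i' j' => if (i' == i) && (j' == j) then x i j else 0.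
have -> : x = \sum_(i < N) \sum_(j < N) comp i j.
  apply/funext => i'; apply/funext => j'; rewrite fam_sum.
  under eq_bigr => i _.
    rewrite fam_sum /comp; under eq_bigr => j _ do rewrite [i' == i]eq_sym [j' == j]eq_sym.
    over.
  rewrite sum2_if_eq; case: ifP => // ij; rewrite xN //.
  by move: ij; lia.
suff [] : homog n (\sum_(i < N) \sum_(j < N) comp i j) /\
    P (\sum_(i < N) \sum_(j < N) comp i j) by [].
(* Homogeneity of the partial sums is carried along, as the additive step of the induction asks for
   it. *)
pose Q z := homog n z /\ P z.
have Q0 : Q 0 by split=> //; apply: homog0.
have QD y z : Q y -> Q z -> Q (y + z).
  by move=> [yn yP] [zn zP]; split; [apply: homogD | apply: PD].
apply: (big_ind Q) => // i _; apply: (big_ind Q) => // j _.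
have comp0 : x i j = 0 -> comp i j = 0.
  move=> z; apply/funext => i'; apply/funext => j'.
  by rewrite /comp z; case: ifP.
have [ijn|/eqP ijn] := eqVneq (j%:Z - i%:Z) n; last by rewrite comp0 // xn.
case ij: ((i == 0 :> nat)%N || (j == 0 :> nat)%N).
  by rewrite comp0 //; apply: gcB_eq0 ij.
have [i1 ei] : exists i1, i = i1.+1 :> nat by exists i.-1; lia.
have [j1 ej] : exists j1, j = j1.+1 :> nat by exists j.-1; lia.
have ijB := xB i j; rewrite ei ej in ijB.
have -> : comp i j = single (Bihom ijB).
  by rewrite /comp /single ei ej.
have e : (hj (Bihom ijB))%:Z - (hi (Bihom ijB))%:Z = n by rewrite /= -ijn ei ej; lia.
by split; [apply: single_homog | apply: PS].
Qed.

Lemma brDl n m x y z : homog n x -> homog n y -> homog m z ->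
  br (x + y) z = br x z + br y z.
Proof.
by move=> [xT _] [yT _] [zT _]; have := br_linl 1 xT yT zT; rewrite !scale1r.
Qed.

Lemma brDr n m x y z : homog n x -> homog n y -> homog m z ->
  br z (x + y) = br z x + br z y.
Proof.
by move=> [xT _] [yT _] [zT _]; have := br_linr 1 xT yT zT; rewrite !scale1r.
Qed.

Lemma hsgn_deg X Y m n : (hj X)%:Z - (hi X)%:Z = m -> (hj Y)%:Z - (hi Y)%:Z = n ->
  hsgn X Y = (-1) ^ (m * n).
Proof. by move=> <- <-; rewrite /hsgn; congr (_ ^ (_ * _)); lia. Qed.

Lemma single_diag X i j : i = (hi X).+1 -> j = (hj X).+1 -> single X i j = hf X.
Proof. by move=> -> ->; rewrite /single !eqxx. Qed.

Lemma singleP X z : hf X = z (hi X).+1 (hj X).+1 ->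
  (forall i j, (i == (hi X).+1) && (j == (hj X).+1) = false -> z i j = 0) ->
  single X = z.
Proof.
move=> Xz z0; apply/funext => i; apply/funext => j; rewrite /single.
by case: ifP => [/andP[/eqP-> /eqP->]|/z0].
Qed.

Let is_single n x := exists2 X, (hj X)%:Z - (hi X)%:Z = n & x = single X.

Let single_ind n (P : F -> Prop) : P 0 ->
  (forall x y, homog n x -> homog n y -> P x -> P y -> P (x + y)) ->
  (forall x, is_single n x -> P x) -> forall x, homog n x -> P x.
Proof. by move=> P0 PD PS; apply: homog_ind => // X Xn; apply: PS; exists X. Qed.

Let is_single_homog n x : is_single n x -> homog n x.
Proof. by case=> X Xn ->; apply: single_homog. Qed.

Lemma br_skew m n x y : homog m x -> homog n y ->
  br x y = - ((-1) ^ (m * n) *: br y x).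
Proof.
apply: (skew_ext homog0 brDl brDr is_single_homog single_ind).
move=> _ _ [X Xm ->] [Y Yn ->]; rewrite !br_single; apply: singleP => [|i j ij].
  set s := (-1) ^ _; apply/funext => v.
  rewrite -[RHS]/(- (s *: single (hbrk comm Y X) (hi (hbrk comm X Y)).+1
    (hj (hbrk comm X Y)).+1 v)).
  rewrite single_diag /=; [|by rewrite addnC|by rewrite addnC].
  rewrite !hbrk_funE.
  rewrite (hsgn_deg Xm Yn) (hsgn_deg Yn Xm) [(n * m)%R]mulrC -/s scalerBr opprB scalerA.
  by rewrite /s int_signE -signr_addb addbb scale1r.
have E (u : F) (s : K) : u i j = 0 -> (- (s *: u)) i j = 0.
  by move=> u0; rewrite -[LHS]/(- (s *: u i j)) u0 scaler0 oppr0.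
by apply: E; rewrite /single /= [(hi Y + _)%N]addnC [(hj Y + _)%N]addnC ij.
Qed.

Lemma br_jacobi m n p x y z : homog m x -> homog n y -> homog p z ->
  br x (br y z) = br (br x y) z + (-1) ^ (m * n) *: br y (br x z).
Proof.
apply: (jacobi_ext homog0 br_homog brDl brDr is_single_homog single_ind).
move=> _ _ _ [X Xm ->] [Y Yn ->] [Z Zp ->]; rewrite !br_single.
set s := (-1) ^ _; apply: singleP => [|i j ij].
  apply/funext => v; rewrite [LHS](hbrk_jacobi comm X Y Z v) (hsgn_deg Xm Yn) -/s.
  set i := (hi _).+1; set j := (hj _).+1.
  rewrite -[RHS]/(single (hbrk comm (hbrk comm X Y) Z) i j v +
    s *: single (hbrk comm Y (hbrk comm X Z)) i j v).
  by rewrite !single_diag //= /i /j /= ?addnA // -addnA addnCA addnA.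
have E (u u' : F) (t : K) : u i j = 0 -> u' i j = 0 -> (u + t *: u') i j = 0.
  by move=> u0 u'0; rewrite -[LHS]/(u i j + t *: u' i j) u0 u'0 scaler0 addr0.
apply: E; rewrite /single /=; move: ij => /=.
  by rewrite !addnA => ->.
by rewrite [(hi Y + (_ + _))%N]addnCA [(hj Y + (_ + _))%N]addnCA => ->.
Qed.

Lemma homog_span x : total x -> exists (s : seq int) (c : int -> F),
  (forall n, homog n (c n)) /\ x = \sum_(n <- s) c n.
Proof.
move=> [xB [N xN]].
pose c (n : int) : F := fun i j => if j%:Z - i%:Z == n then x i j else 0.
(* Nonzero components have both indices below [N], so their degrees lie between [- N] and
   [N - 1]. *)
exists [seq k%:Z - N%:Z | k <- iota 0 N.*2], c; split=> [n|].
  split; first split.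
  - by move=> i j; rewrite /c; case: ifP => _ //; apply: gcB0.
  - by exists N => i j ij; rewrite /c xN //; case: ifP.
  by move=> i j /eqP/negbTE ij; rewrite /c ij.
apply/funext => i; apply/funext => j; rewrite fam_sum big_map.
have [ij|ij] := boolP ((N <= i)%N || (N <= j)%N).
  by rewrite xN // big1 // => k _; rewrite /c xN //; case: ifP.
(* This is the position of the degree [j - i] in the list. *)
rewrite (bigD1_seq (j + N - i)%N) ?iota_uniq //=; last by rewrite mem_iota; lia.
rewrite /c big1 => [|k ki]; last by case: ifP => // /eqP E; case/eqP: ki; lia.
by rewrite addr0 ifT //; lia.
Qed.

Lemma homog_direct (s : seq int) (c : int -> F) : uniq s ->
  (forall n, homog n (c n)) -> \sum_(n <- s) c n = 0 ->
  forall n, n \in s -> c n = 0.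
Proof.
move=> su cH c0 n ns; apply/funext => i; apply/funext => j.
have [ij|/eqP ij] := eqVneq (j%:Z - i%:Z) n; last by have [_ ->] := cH n.
have := congr1 (fun h : F => h i j) c0; rewrite /= fam_sum (bigD1_seq n) //=.
rewrite big1 ?addr0 // => k kn; have [_ ->] := cH k => //.
by rewrite ij => nk; case/eqP: kn.
Qed.

End Families.

Theorem theorem8p1 (K : fieldType) (charK : [pchar K] =i pred0)
    (g : lmodType K) (alpha beta : {linear g -> g})
    (comm : forall x : g, alpha (beta x) = beta (alpha x)) :
  graded_lie_algebra (gc_total alpha beta) (gc_homog alpha beta)
    (gc_bracket alpha beta).
Proof.
split.
- exact: total_subspace.
- exact: homog_subspace.
- by move=> n x [].
- exact: homog_span.
- exact: homog_direct.
- by move=> a x y z; apply: br_linl.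
- by move=> a x y z xT yT zT; apply: br_linr.
- exact: br_homog.
- exact: br_skew.
- exact: br_jacobi.
Qed.
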